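(* Let $p(z)=z^d+a_{d-1}z^{d-1}+\cdots+a_1z+a_0$ be an expanding polynomial with integer coefficients, leading coefficient $1$ and free term $a_0=\pm2$, and suppose that $p$ is isotropic. Let $M$ be the companion matrix of $p$ and let $D=\{\boldsymbol 0,\boldsymbol e\}$, where $\boldsymbol e=(1,0,\ldots,0)^T\in\mathbb{R}^d$. Then the 2-attractor $G(M,D)$ is a tile.
   Context: A polynomial is expanding if all its complex roots have modulus strictly greater than $1$, and isotropic if all its complex roots have the same modulus. The companion matrix of $p(z)=z^d+a_{d-1}z^{d-1}+\cdots+a_0$ is the $d\times d$ matrix $M$ with $M_{i+1,i}=1$ for $i=1,\ldots,d-1$, last column $(-a_0,-a_1,\ldots,-a_{d-1})^T$, and all other entries $0$ (for $d=1$, $M=(-a_0)$). The 2-attractor generated by $M$ and $D$ is the compact set $G(M,D)=\{\sum_{k=1}^{\infty}M^{-k}\boldsymbol a_k : \boldsymbol a_k\in D \text{ for all } k\}\subset\mathbb{R}^d$. An attractor is called a tile if its Lebesgue measure equals $1$ (equivalently, its integer shifts cover $\mathbb{R}^d$ with pairwise intersections of measure zero). *)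

(* Defs.v *)
From HB Require Import structures.
From mathcomp Require Import all_boot all_order all_algebra.
From mathcomp Require Import all_classical all_reals all_analysis.
From mathcomp.real_closed Require Import complex.

Set Implicit Arguments.
Unset Strict Implicit.
Unset Printing Implicit Defensive.

Import Order.TTheory GRing.Theory Num.Theory.
Import numFieldNormedType.Exports.

Local Open Scope classical_set_scope.
Local Open Scope ring_scope.

(* On R[i] the order relates only numbers with equal imaginary parts, but
   `|z| is always a nonnegative real, so these comparisons are those of R. *)
Definition expanding (R : realType) (p : {poly R[i]}) : Prop :=
  forall z : R[i], root p z -> 1 < `|z|.

Definition isotropic (R : realType) (p : {poly R[i]}) : Prop :=
  forall z w : R[i], root p z -> root p w -> `|z| = `|w|.

(* The library's companionmx carries the coefficients in its last row; the
   transpose carries them in the last column, with ones below the diagonal. *)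
Definition companion (R : realType) (p : {poly int}) : 'M[R]_((size p).-1) :=
  map_mx intr (companionmx p)^T.

(* Convergence is in 'cV[R]_d with its product topology. *)
Definition attractor (R : realType) (d : nat) (M : 'M[R]_d)
    (D : set 'cV[R]_d) : set 'cV[R]_d :=
  [set x | exists a : nat -> 'cV[R]_d, (forall k, D (a k)) /\
     (fun n => \sum_(1 <= k < n) (invmx M ^+ k *m a k)) @ \oo --> x].

Definition tuple_cons (T : Type) (n : nat) (y : T * n.-tuple T) :
    n.+1.-tuple T :=
  [tuple of y.1 :: y.2].

Lemma measurable_tuple_cons d (T : measurableType d) (n : nat) :
  measurable_fun setT (@tuple_cons T n).
Proof.
apply: (@measurable_cons _ _ (T * n.-tuple T)%type T fst n snd).
  exact: measurable_fst.
exact: measurable_snd.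
Qed.

Definition tuple_cons_measure (R : realType) d (T : measurableType d) (n : nat)
    (m1 : set T -> \bar R) (m2 : set (n.-tuple T) -> \bar R) :
    set (n.+1.-tuple T) -> \bar R :=
  pushforward (product_measure1 m1 m2) (@tuple_cons T n).

Section tuple_cons_measure.
Context (R : realType) d (T : measurableType d) (n : nat).
Variables (m1 : {sigma_finite_measure set T -> \bar R})
          (m2 : {sigma_finite_measure set (n.-tuple T) -> \bar R}).

Let mu : {measure set (T * n.-tuple T)%type -> \bar R} :=
  product_measure1 m1 m2.
Let nu := tuple_cons_measure m1 m2.

Let nu0 : nu set0 = 0%E.
Proof. by rewrite /nu /tuple_cons_measure /pushforward preimage_set0 measure0. Qed.

Let nu_ge0 A : (0 <= nu A)%E.
Proof. exact: (measure_ge0 mu). Qed.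

Let nu_sigma_additive : semi_sigma_additive nu.
Proof.
move=> F mF tF mUF; rewrite /nu /tuple_cons_measure /pushforward.
rewrite preimage_bigcup; apply: (@measure_semi_sigma_additive _ _ _ mu).
- by move=> k; rewrite -[X in measurable X]setTI; exact: measurable_tuple_cons.
- by move=> i j _ _ [y [Fi Fj]]; apply: tF => //; exists (tuple_cons y).
- rewrite -preimage_bigcup -[X in measurable X]setTI.
  exact: measurable_tuple_cons.
Qed.

HB.instance Definition _ :=
  isMeasure.Build _ _ _ nu nu0 nu_ge0 nu_sigma_additive.

Let nu_sigma_finite : sigma_finite setT nu.
Proof.
have /sigma_finiteP[F [TF ndF Foo]] := sigma_finiteT m1.
have /sigma_finiteP[G [TG ndG Goo]] := sigma_finiteT m2.
pose g (t : n.+1.-tuple T) := (thead t, [tuple of behead t]).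
have mg : measurable_fun setT g.
  apply/measurable_fun_pairP; split; first exact: measurable_tnth.
  exact: measurable_behead.
have fK : cancel (@tuple_cons T n) g.
  by move=> [x t]; congr pair; apply: val_inj.
exists (fun k => g @^-1` (F k `*` G k)).
  rewrite -preimage_bigcup (_ : \bigcup_k _ = setT) ?preimage_setT//.
  apply/seteqP; split => // -[x t] _.
  have [i _ Fx] : (\bigcup_k F k) x by rewrite -TF.
  have [j _ Gt] : (\bigcup_k G k) t by rewrite -TG.
  exists (maxn i j) => //; split => /=.
    by move: x Fx; exact/subsetPset/ndF/leq_maxl.
  by move: t Gt; exact/subsetPset/ndG/leq_maxr.
move=> k; have [mF Fk] := Foo k; have [mG Gk] := Goo k; split.
  by rewrite -[X in measurable X]setTI; apply: mg => //; exact: measurableX.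
rewrite /nu /tuple_cons_measure /pushforward -comp_preimage.
rewrite (_ : g \o _ = id); last by apply/funext => y /=; rewrite fK.
by rewrite preimage_id product_measure1E// lte_mul_pinfty// ge0_fin_numE.
Qed.

HB.instance Definition _ :=
  Measure_isSigmaFinite.Build _ _ _ nu nu_sigma_finite.

End tuple_cons_measure.

(* The n-fold product of the Lebesgue measure of R, on the product
   sigma-algebra of n.-tuple; see lebesgue_tuple_box. *)
Fixpoint lebesgue_tuple (R : realType) (n : nat) :
    {sigma_finite_measure set (n.-tuple (measurableTypeR R)) -> \bar R} :=
  match n with
  | 0 => dirac [tuple]
  | n'.+1 => tuple_cons_measure (@lebesgue_measure R) (lebesgue_tuple R n')
  end.

Lemma lebesgue_tuple_box (R : realType) (n : nat)
    (A : 'I_n -> set (measurableTypeR R)) :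
  (forall i, measurable (A i)) ->
  lebesgue_tuple R n [set t | forall i, A i (tnth t i)] =
  (\prod_(i < n) lebesgue_measure (A i))%E.
Proof.
elim: n A => [|n IHn] A mA.
  by rewrite big_ord0 /= diracE mem_set// => -[].
rewrite big_ord_recl -IHn; last by move=> i; exact: mA.
rewrite -product_measure1E//; last first.
  rewrite (_ : [set t | _] = \bigcap_(i in [set: 'I_n])
      ((fun t : n.-tuple (measurableTypeR R) => tnth t i) @^-1`
        A (lift ord0 i))).
    apply: fin_bigcap_measurable => [|i _]; first exact: finite_finset.
    by rewrite -[X in measurable X]setTI; exact: measurable_tnth.
  by apply/seteqP; split => t At i => [_|]; [exact: At|exact: At].
rewrite /= /tuple_cons_measure /pushforward; congr product_measure1.
apply/seteqP; split => -[x t] /=.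
  move=> Axt; split; first exact: (Axt ord0).
  by move=> i; have := Axt (lift ord0 i); rewrite tnthS.
move=> [Ax At] i; case: (unliftP ord0 i) => [j ->|->//].
by rewrite tnthS; exact: At.
Qed.

Definition col_tuple (R : realType) (d : nat)
    (t : d.-tuple (measurableTypeR R)) : 'cV[R]_d :=
  \col_i (tnth t i : R).

(* Outside the sigma-algebra the values of lebesgue_tuple carry no meaning, so
   having measure 1 includes being measurable. *)
Definition tile (R : realType) (d : nat) (A : set 'cV[R]_d) : Prop :=
  measurable (@col_tuple R d @^-1` A) /\
  lebesgue_tuple R d (@col_tuple R d @^-1` A) = 1%E.

(* Main.v *)
Require Import Defs.
From mathcomp Require Import all_boot all_order all_algebra.
From mathcomp Require Import all_classical all_reals all_analysis.
From mathcomp.real_closed Require Import complex.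
From mathcomp Require Import measurable_realfun ring lra zify.

(** Write d for the degree of p. All roots have modulus 2^(1/d), so complex
    conjugation is x |-> rho / x on them, with rho^d = 4. Comparing
    coefficients gives a_i rho^i = a_0 a_(d-i), and the 2-adic valuation of the
    d-th power of this identity forces a_i = 0 unless i is 0, d/2 or d. Hence
    p(X) = q(X^m) with q = X +- 2 or q = X^2 + aX + 2, |a| <= 2.

    For such q every integer polynomial is congruent modulo q to one with
    coefficients in {-1, 0, 1}: choose the sign of an odd digit so that the norm
    form of Z[X]/(q) decreases. The same follows modulo p. Therefore every
    nonzero z in Z^d is reached from 0 by the maps z |-> M z + c e with
    c = -1, 0, 1. The attractor G satisfies M G = G u (G + e) and M doubles
    volumes, so G and G + e overlap in a null set, and if G and G + z do, then
    so do G and G + M z + c e. Thus all translates of G by distinct integer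
    vectors overlap in null sets; as they cover R^d, G has measure 1. *)

Set Implicit Arguments.
Unset Strict Implicit.
Unset Printing Implicit Defensive.

Import Order.TTheory GRing.Theory Num.Theory.
Import numFieldNormedType.Exports.

Local Open Scope classical_set_scope.
Local Open Scope ring_scope.

(** * Lebesgue measure on tuples *)

Lemma tuple_box_measurable (R : realType) n
    (A : 'I_n -> set (measurableTypeR R)) :
  (forall i, measurable (A i)) -> measurable [set t | forall i, A i (tnth t i)].
Proof.
move=> mA; rewrite (_ : [set t | _] = \bigcap_(i in [set: 'I_n])
    ((fun t : n.-tuple (measurableTypeR R) => tnth t i) @^-1` A i)).
  apply: fin_bigcap_measurable => [|i _]; first exact: finite_finset.
  by rewrite -[X in measurable X]setTI; exact: measurable_tnth.
by apply/seteqP; split => t At i => [_|]; [exact: At|exact: At].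
Qed.

(** Boxes are stable under intersection, generate the product sigma-algebra and include the cubes
    [[-k, k]^n], which have finite measure and exhaust the space. Translations and the splitting off
    of the last coordinate are thereby checked on boxes only. *)
Lemma lebesgue_tuple_unique (R : realType) n
    (m : {measure set (n.-tuple (measurableTypeR R)) -> \bar R}) :
  (forall A : 'I_n -> set (measurableTypeR R), (forall i, measurable (A i)) ->
    m [set t | forall i, A i (tnth t i)] =
    (\prod_(i < n) lebesgue_measure (A i))%E) ->
  forall X, measurable X -> lebesgue_tuple R n X = m X.
Proof.
move=> mbox X mX.
pose G : set (set (n.-tuple (measurableTypeR R))) :=
  [set B | exists2 A : 'I_n -> set (measurableTypeR R),
    (forall i, measurable (A i)) & B = [set t | forall i, A i (tnth t i)]].
pose g k : set (n.-tuple (measurableTypeR R)) := [set t | forall i : 'I_n,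
  [set` `[(- k%:R : R), k%:R]] (tnth t i)].
apply: (measure_unique G g) => //.
- apply/seteqP; split; last first.
    apply: smallest_sub; first exact: sigma_algebra_measurable.
    by move=> _ [A mA ->]; exact: tuple_box_measurable.
  rewrite /measurable/=; apply: smallest_sub; first exact: smallest_sigma_algebra.
  rewrite -bigcup_seq => _ [i _ [B mB <-]]; apply: sub_sigma_algebra.
  (* A cylinder over one coordinate is the box whose other sides are the whole line. *)
  exists (fun j => if j == i then B else setT).
    by move=> j; case: ifP.
  rewrite setTI; apply/seteqP; split => t /=.
    by move=> Bt j; case: ifPn => // /eqP ->.
  by move=> /(_ i); rewrite eqxx.
- move=> _ _ [A mA ->] [B mB ->]; exists (fun i => A i `&` B i).
    by move=> i; exact: measurableI.
  apply/seteqP; split => t /=; first by move=> [At Bt] i; split.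
  by move=> ABt; split => i; have [] := ABt i.
- by move=> k; exists (fun=> [set` `[- k%:R, k%:R]%R]) => // i; exact: measurable_itv.
- apply/seteqP; split => // t _.
  exists (\max_(i < n) `|Num.ceil `|tnth t i : R| |)%N => // i.
  rewrite /= in_itv/= -ler_norml (le_trans (ceil_ge _))//.
  rewrite -[X in X%:~R]gez0_abs ?ceil_ge0 ?(lt_le_trans _ (normr_ge0 _))//.
  by rewrite -pmulrn ler_nat; exact: (leq_bigmax i).
- move=> _ [A mA ->]; rewrite mbox//; exact: lebesgue_tuple_box.
- move=> k; rewrite -ge0_fin_numE//.
  rewrite [X in X \is a _](lebesgue_tuple_box
    (fun=> measurable_itv `[- k%:R, k%:R])).
  elim/big_ind: _ => // [x y|i _]; first exact: fin_numM.
  by rewrite lebesgue_measure_itv/=; case: ifP.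
Qed.

Definition measure_pushforward d1 d2 (T1 : measurableType d1)
    (T2 : measurableType d2) (R : realType) (m : {measure set T1 -> \bar R})
    (f : T1 -> T2) (mf : measurable_fun setT f) : {measure set T2 -> \bar R} :=
  measure_function_pushforward__canonical__measure_function_Measure m mf.

(** Uniqueness of Lebesgue measure reduces this to half-open intervals; for negative [c] the
    preimage of such an interval is half-open on the other side. *)
Lemma lebesgue_measure_affine (R : realType) (c t : R)
    (A : set (measurableTypeR R)) :
  c != 0 -> measurable A ->
  (`|c|%:E * lebesgue_measure [set x : R | A (c * x + t)%R] =
   lebesgue_measure A)%E.
Proof.
move=> c0 mA.
have mf : measurable_fun setT
    ((fun x => c * x + t) : measurableTypeR R -> measurableTypeR R).
  by apply: measurable_funD => //; exact: measurable_funM.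
pose r : {nonneg R} := NngNum (normr_ge0 c).
suff : lebesgue_measure A =
    mscale r (measure_pushforward lebesgue_measure mf) A by [].
apply: lebesgue_measure_unique => // _ [[a b] _ <-] /=.
rewrite /mscale /= /pushforward /preimage /=.
have [cp|cn|c00] := ltgtP c 0; last by rewrite c00 eqxx in c0.
- rewrite [in RHS](_ : [set x : R | _] = `[(b - t) / c, (a - t) / c[%classic).

    rewrite !lebesgue_measure_itv/=. rewrite !lte_fin ltr_nM2r ?invr_lt0// ltrD2r.
    case: ifP => _; last by rewrite mule0.
    by rewrite ltr0_norm// -!EFinD -EFinM; congr EFin; field.
  apply/seteqP; split => x /=; rewrite !in_itv/= ler_ndivrMr// ltr_ndivlMr//.
    by move=> /andP[h1 h2]; apply/andP; split; lra.
  by move=> /andP[h1 h2]; apply/andP; split; lra.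
- rewrite [in RHS](_ : [set x : R | _] = `](a - t) / c, (b - t) / c]%classic).
    rewrite !lebesgue_measure_itv/= !lte_fin ltr_pM2r ?invr_gt0// ltrD2r.
    case: ifP => _; last by rewrite mule0.
    by rewrite gtr0_norm// -!EFinD -EFinM; congr EFin; field.
  apply/seteqP; split => x /=; rewrite !in_itv/= ltr_pdivrMr// ler_pdivlMr//.
    by move=> /andP[h1 h2]; apply/andP; split; lra.
  by move=> /andP[h1 h2]; apply/andP; split; lra.
Qed.

Lemma measurable_mktuple d (T : measurableType d) (R : realType) n
    (F : 'I_n -> T -> measurableTypeR R) :
  (forall i, measurable_fun setT (F i)) ->
  measurable_fun setT (fun x => [tuple F i x | i < n]).
Proof.
move=> mF; apply/measurable_fun_tnthP => i.
by rewrite (_ : _ \o _ = F i)//; apply/funext => x /=; rewrite tnth_mktuple.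
Qed.

Lemma lebesgue_tuple_translate (R : realType) n (v : 'I_n -> R)
    (A : set (n.-tuple (measurableTypeR R))) :
  measurable A ->
  lebesgue_tuple R n [set t | A [tuple (tnth t i : R) + v i | i < n]] =
  lebesgue_tuple R n A.
Proof.
move=> mA.
pose f (t : n.-tuple (measurableTypeR R)) :
  n.-tuple (measurableTypeR R) := [tuple (tnth t i : R) + v i | i < n].
have mf : measurable_fun setT f.
  apply: measurable_mktuple => i.
  by apply: measurable_funD => //; exact: measurable_tnth.
symmetry; rewrite -[RHS]/(measure_pushforward (lebesgue_tuple R n) mf A).
apply: lebesgue_tuple_unique => // B mB; rewrite /= /pushforward.
pose Bv i : set (measurableTypeR R) := [set x | B i ((x : R) + v i)].
have mBv i : measurable (Bv i).
  have mfi : measurable_fun setT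
      ((fun x => (x : R) + v i) : measurableTypeR R -> measurableTypeR R).
    exact: measurable_funD.
  by rewrite -[X in measurable X]setTI; exact: mfi.
rewrite (_ : _ @^-1` _ = [set t | forall i, Bv i (tnth t i)]).
  rewrite lebesgue_tuple_box//; apply: eq_bigr => i _.
  rewrite -(lebesgue_measure_affine (v i) (oner_neq0 R) (mB i)) normr1 mul1e.
  congr (lebesgue_measure _); by apply/seteqP; split => x; rewrite /= mul1r.
by apply/seteqP; split => t /= Bt i; have := Bt i; rewrite tnth_mktuple.
Qed.

(** [lebesgue_tuple] is built by adding a first coordinate, whereas a companion matrix singles out
    the last one. Splitting off the last coordinate yields a measure with the same values on
    boxes. *)
Lemma lebesgue_tuple_rcons (R : realType) n
    (A : set (n.+1.-tuple (measurableTypeR R))) :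
  measurable A ->
  lebesgue_tuple R n.+1 A =
  product_measure1 (@lebesgue_measure R) (lebesgue_tuple R n)
    [set x | A (rcons_tuple x.2 x.1)].
Proof.
move=> mA.
pose f (x : measurableTypeR R * n.-tuple (measurableTypeR R)) :
  n.+1.-tuple (measurableTypeR R) := rcons_tuple x.2 x.1.
have tf x (i : 'I_n) : tnth (f x) (widen_ord (leqnSn n) i) = tnth x.2 i.
  by rewrite !(tnth_nth x.1) /= nth_rcons size_tuple ltn_ord.
have tfm x : tnth (f x) ord_max = x.1.
  by rewrite !(tnth_nth x.1) /= nth_rcons size_tuple ltnn eqxx.
have mf : measurable_fun setT f.
  apply/measurable_fun_tnthP => i.
  have [in_|ni] := ltnP i n.
    rewrite (_ : _ \o _ = (fun t => tnth t (Ordinal in_)) \o snd).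
      by apply: measurableT_comp => //; exact: measurable_tnth.
    apply/funext => x /=; rewrite -tf; congr tnth; exact: val_inj.
  rewrite (_ : _ \o _ = fst) //.
  apply/funext => x /=; rewrite -tfm; congr tnth; apply: val_inj => /=.
  by apply/eqP; rewrite eqn_leq ni -ltnS ltn_ord.
rewrite -[RHS]/(measure_pushforward
  (product_measure1 (@lebesgue_measure R) (lebesgue_tuple R n)) mf A).
apply: lebesgue_tuple_unique => // B mB; rewrite /= /pushforward.
rewrite (_ : _ @^-1` _ = B ord_max `*`
   [set t | forall i : 'I_n, B (widen_ord (leqnSn n) i) (tnth t i)]).
  rewrite product_measure1E//; last first.
    exact: (tuple_box_measurable (fun i => mB (widen_ord (leqnSn n) i))).
  rewrite (lebesgue_tuple_box (fun i => mB (widen_ord (leqnSn n) i))).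
  by rewrite big_ord_recr /= muleC.
apply/seteqP; split => x /=.
  move=> Bx; split; first by have := Bx ord_max; rewrite tfm.
  by move=> i; rewrite -tf.
move=> [Bx1 Bx2] i; have [in_|ni] := ltnP i n.
  rewrite (_ : i = widen_ord (leqnSn n) (Ordinal in_)); last exact: val_inj.
  by rewrite tf.
rewrite (_ : i = ord_max) ?tfm//; apply: val_inj => /=.
by apply/eqP; rewrite eqn_leq ni -ltnS ltn_ord.
Qed.

(** The substitution is the action of a companion matrix with last column [(c, v)]. With the last
    coordinate split off in the source and the first one in the target, it becomes a shear combined
    with a scaling of one axis. *)
Lemma lebesgue_tuple_companion (R : realType) n (c : R) (v : 'I_n -> R)
    (A : set (n.+1.-tuple (measurableTypeR R))) :
  c != 0 -> measurable A ->
  (`|c|%:E * lebesgue_tuple R n.+1 [set t | A (tuple_cons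
      ((c * (tnth t ord_max : R))%R,
       [tuple ((tnth t (widen_ord (leqnSn n) i) : R) +
               v i * (tnth t ord_max : R))%R | i < n]))] =
   lebesgue_tuple R n.+1 A)%E.
Proof.
move=> c0 mA.
set S := [set t | _].
pose T := (measurableTypeR R * n.-tuple (measurableTypeR R))%type.
pose psi (x : T) : T :=
  (c * (x.1 : R), [tuple (tnth x.2 i : R) + v i * x.1 | i < n]).
have mpsi : measurable_fun setT psi.
  apply/measurable_fun_pairP; split.
    by rewrite /comp/=; apply: measurable_funM.
  apply: measurable_mktuple => i.
  apply: measurable_funD; last by apply: measurable_funM.
  apply: (@measurableT_comp _ _ _ _ _ _ (fun t => tnth t i)) => //.
  exact: measurable_tnth.
have mS : measurable S.
  rewrite -[X in measurable X]setTI.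
  pose g (t : n.+1.-tuple (measurableTypeR R)) : T :=
    (c * (tnth t ord_max : R),
     [tuple (tnth t (widen_ord (leqnSn n) i) : R) +
            v i * (tnth t ord_max : R) | i < n]).
  apply: (@measurableT_comp _ _ _ _ _ _
    (@tuple_cons (measurableTypeR R) n) _ g) => //.
    exact: measurable_tuple_cons.
  apply: measurable_fun_pair.
    by apply: measurable_funM => //; exact: measurable_tnth.
  apply: measurable_mktuple => i.
  apply: measurable_funD; first exact: measurable_tnth.
  by apply: measurable_funM => //; exact: measurable_tnth.
pose r : {nonneg R} := NngNum (normr_ge0 c).
pose mm : {measure set T -> \bar R} := mscale r
  (measure_pushforward
    (product_measure1 (@lebesgue_measure R) (lebesgue_tuple R n)) mpsi).
(* Slicing along the last coordinate t turns the map into t |-> c t followed by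
   a translation of the other coordinates. *)
have mmE X : measurable X ->
    product_measure1 (@lebesgue_measure R) (lebesgue_tuple R n) X = mm X.
  apply: product_measure_unique => A1 A2 mA1 mA2.
  rewrite /mm /mscale /= /pushforward.
  (* The slice at [s] of the preimage of the rectangle is a translate of [A2] if [c * s] lies in
     [A1], and empty otherwise. The summand 0 matches [lebesgue_measure_affine]. *)
  transitivity (`|c|%:E *
      product_measure1 (@lebesgue_measure R) (lebesgue_tuple R n)
        ([set x : R | A1 (c * x + 0)%R] `*` A2))%E.
    congr (_ * _)%E; apply: esym.
    rewrite /product_measure1; apply: eq_integral => s _ /=.
    have [cs|cs] := pselect (A1 (c * (s : R))).
      rewrite in_xsectionX ?inE/= ?addr0//.
      rewrite -(lebesgue_tuple_translate (fun i => v i * (s : R)) mA2).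
      congr (lebesgue_tuple R n _); apply/seteqP.
      by split => t /=; rewrite /xsection/= inE/= => // -[].
    have csF : s \notin [set x : measurableTypeR R | A1 (c * (x : R) + 0)].
      by apply/negP; rewrite inE/= addr0.
    rewrite notin_xsectionX//; congr (lebesgue_tuple R n _).
    apply/seteqP; split => // t.
    by rewrite /xsection/= inE/= => -[].
  have mf : measurable_fun setT
      ((fun x => c * x + 0) : measurableTypeR R -> measurableTypeR R).
    by apply: measurable_funD => //; exact: measurable_funM.
  rewrite product_measure1E ?muleA ?lebesgue_measure_affine//.
  by rewrite -[X in measurable X]setTI; exact: mf.
rewrite [in LHS]lebesgue_tuple_rcons//.
rewrite -[RHS]/(product_measure1 (@lebesgue_measure R) (lebesgue_tuple R n)
  (@tuple_cons (measurableTypeR R) n @^-1` A)).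
rewrite [RHS]mmE; last first.
  rewrite -[X in measurable X]setTI.
  exact: (measurable_tuple_cons measurableT mA).
rewrite /mm /mscale /= /pushforward; congr (_ * product_measure1 _ _ _)%E.
have tf (x : T) (i : 'I_n) :
    tnth (rcons_tuple x.2 x.1) (widen_ord (leqnSn n) i) = tnth x.2 i.
  by rewrite !(tnth_nth x.1) /= nth_rcons size_tuple ltn_ord.
have tfm (x : T) : tnth (rcons_tuple x.2 x.1) ord_max = x.1.
  by rewrite !(tnth_nth x.1) /= nth_rcons size_tuple ltnn eqxx.
apply/seteqP; split => x; rewrite /S /psi /= tfm.
  by under eq_mktuple do rewrite tf.
by under [in X in _ -> X]eq_mktuple do rewrite tf.
Qed.

(** * Volume of sets of column vectors *)

Definition volume (R : realType) d (A : set 'cV[R]_d) : \bar R :=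
  lebesgue_tuple R d (@col_tuple R d @^-1` A).

Definition cV_measurable (R : realType) d (A : set 'cV[R]_d) : Prop :=
  measurable (@col_tuple R d @^-1` A).

Lemma cV_measurable_affine (R : realType) d (M : 'M[R]_d) v (A : set 'cV[R]_d) :
  cV_measurable A -> cV_measurable [set x | A (M *m x + v)].
Proof.
move=> mA.
pose f (t : d.-tuple (measurableTypeR R)) : d.-tuple (measurableTypeR R) :=
  [tuple (M *m col_tuple t + v) i 0 | i < d].
have mf : measurable_fun setT f.
  apply: measurable_mktuple => i.
  rewrite (_ : (fun t => _) =
      (fun t => \sum_j M i j * (tnth t j : R) + v i 0)).
    apply: measurable_funD => //; apply: measurable_sum => j.
    by apply: measurable_funM => //; exact: measurable_tnth.
  apply/funext => t; rewrite !mxE; congr (_ + _).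
  by apply: eq_bigr => j _; rewrite mxE.
rewrite /cV_measurable (_ : _ @^-1` _ = f @^-1` (@col_tuple R d @^-1` A)).
  by rewrite -[X in measurable X]setTI; exact: mf.
have fE t : col_tuple (f t) = M *m col_tuple t + v.
  by apply/colP => i; rewrite [LHS]mxE tnth_mktuple.
by apply/seteqP; split => t /=; rewrite fE.
Qed.

Lemma cV_measurable_linear (R : realType) d (M : 'M[R]_d) (A : set 'cV[R]_d) :
  cV_measurable A -> cV_measurable [set x | A (M *m x)].
Proof.
move=> /(cV_measurable_affine M 0).
by under eq_set do rewrite addr0.
Qed.

Lemma cV_measurable_shift (R : realType) d v (A : set 'cV[R]_d) :
  cV_measurable A -> cV_measurable [set x | A (x + v)].
Proof.
move=> /(cV_measurable_affine 1%:M v).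
by under eq_set do rewrite mul1mx.
Qed.

Lemma volume_shift (R : realType) d v (A : set 'cV[R]_d) :
  cV_measurable A -> volume [set x | A (x + v)] = volume A.
Proof.
move=> mA; rewrite /volume -[RHS](lebesgue_tuple_translate (v ^~ 0))//.
congr (lebesgue_tuple R d _).
have E t : col_tuple [tuple (tnth t i : R) + v i 0 | i < d] = col_tuple t + v.
  by apply/colP => i; rewrite !mxE tnth_mktuple.
by apply/seteqP; split => t /=; rewrite E.
Qed.

(** Up to sign, [p 0] is the determinant of [M]. *)
Lemma volume_companion (R : realType) d (p : nat -> R) (M : 'M[R]_d)
    (A : set 'cV[R]_d) :
  (0 < d)%N -> p 0%N != 0 ->
  (forall i j : 'I_d,
    M i j = if j == d.-1 :> nat then - p i else (j.+1 == i)%:R) ->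
  cV_measurable A -> (`|p 0%N|%:E * volume [set x | A (M *m x)] = volume A)%E.
Proof.
case: d M A => // n M A _ p0 ME mA.
rewrite /volume -[RHS](@lebesgue_tuple_companion _ _ (- p 0%N)
  (fun i => - p i.+1)) ?oppr_eq0//.
rewrite normrN; congr (_ * lebesgue_tuple R n.+1 _)%E.
have E t : col_tuple (tuple_cons (- p 0%N * (tnth t ord_max : R),
     [tuple (tnth t (widen_ord (leqnSn n) i) : R) +
            - p i.+1 * (tnth t ord_max : R) | i < n])) =
    M *m col_tuple t :> 'cV[R]_n.+1.
  apply/colP => i; rewrite !mxE big_ord_recr /= ME eqxx mxE.
  case: (unliftP ord0 i) => [j ->|->].
    rewrite tnthS tnth_mktuple; congr (_ + _).
    rewrite (bigD1 j)//= big1 ?addr0.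
      by rewrite ME /= ltn_eqF// mxE eqSS eqxx mul1r.
    move=> k kj; rewrite ME /= ltn_eqF// eqSS.
    by rewrite (_ : (_ == _) = false) ?mul0r//; apply: negbTE.
  rewrite big1 ?add0r// => k _.
  by rewrite ME /= ltn_eqF// mul0r.
by apply/seteqP; split => t /=; rewrite E.
Qed.

Definition cube (R : realType) d (K : R) : set 'cV[R]_d :=
  [set x | forall i, `|x i 0| <= K].

Definition unit_cell (R : realType) d : set 'cV[R]_d :=
  [set x | forall i, 0 <= x i 0 < 1].

Lemma cube_measurable (R : realType) d K : cV_measurable (@cube R d K).
Proof.
have mA (i : 'I_d) : measurable ([set` `[- K, K]%R] : set (measurableTypeR R)).
  exact: measurable_itv.
rewrite /cV_measurable; have := tuple_box_measurable mA.
by congr (measurable _); apply/seteqP; split => t /= h i; have := h i;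
   rewrite mxE in_itv/= ler_norml.
Qed.

Lemma volume_cube_fin (R : realType) d K : (volume (@cube R d K) < +oo)%E.
Proof.
have mA (i : 'I_d) : measurable ([set` `[- K, K]%R] : set (measurableTypeR R)).
  exact: measurable_itv.
have := lebesgue_tuple_box mA.
rewrite (_ : [set t | _] = @col_tuple R d @^-1` (@cube R d K)); last first.
  by apply/seteqP; split => t /= h i; have := h i;
   rewrite mxE in_itv/= ler_norml.
rewrite /volume => ->; rewrite ltey_eq; apply/orP; left.
elim/big_ind: _ => // [x y|i _]; first exact: fin_numM.
by rewrite lebesgue_measure_itv/=; case: ifP.
Qed.

Lemma unit_cell_measurable (R : realType) d : cV_measurable (@unit_cell R d).
Proof.
have mA (i : 'I_d) : measurable ([set` `[0, 1[%R] : set (measurableTypeR R)).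
  exact: measurable_itv.
rewrite /cV_measurable; have := tuple_box_measurable mA.
by congr (measurable _); apply/seteqP; split => t /= h i; have := h i;
   rewrite mxE in_itv/=.
Qed.

Lemma volume_unit_cell (R : realType) d : volume (@unit_cell R d) = 1%E.
Proof.
have mA (i : 'I_d) : measurable ([set` `[0, 1[%R] : set (measurableTypeR R)).
  exact: measurable_itv.
have := lebesgue_tuple_box mA.
rewrite (_ : [set t | _] = @col_tuple R d @^-1` (@unit_cell R d)); last first.
  by apply/seteqP; split => t /= h i; have := h i; rewrite mxE in_itv/=.
rewrite /volume => ->; rewrite big1// => i _.
by rewrite lebesgue_measure_itv/= lte_fin ltr01 oppr0 adde0.
Qed.

(** Removing from each set its predecessors makes the family disjoint and costs only a finite union
    of null sets. *)
Lemma measure_bigcup_overlap0 d (T : measurableType d) (R : realType)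
    (mu : {measure set T -> \bar R}) (F : nat -> set T) :
  (forall k, measurable (F k)) ->
  (forall j k, (j < k)%N -> mu (F k `&` F j) = 0%E) ->
  (mu (\bigcup_k F k) = \sum_(k <oo) mu (F k))%E.
Proof.
move=> mF F0; rewrite seqDU_bigcup_eq measure_semi_bigcup//; last 2 first.
- by move=> k; apply: measurableD => //; exact: bigsetU_measurable.
- apply: bigcupT_measurable => k.
  by apply: measurableD => //; exact: bigsetU_measurable.
apply: eq_eseriesr => k _; apply/esym.
have mU n : measurable (\big[setU/set0]_(j < n) F j).
  exact: bigsetU_measurable.
suff F0U n : (n <= k)%N -> mu (F k `&` \big[setU/set0]_(j < n) F j) = 0%E.
  by rewrite (measureDI mu (mF k) (mU k)) [X in (_ + X)%E](F0U k (leqnn k)) adde0.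
elim: n => [_|n IH nk]; first by rewrite big_ord0 setI0 measure0.
rewrite big_ord_recr /= setIUr; apply/eqP; rewrite -measure_le0.
apply: le_trans.
  by apply: measureU2; apply: measurableI => //; exact: mU.
by rewrite [X in (X + _)%E](IH (ltnW nk)) [X in (_ + X)%E](F0 _ _ nk) adde0.
Qed.

(** Inclusion-exclusion: both copies of [G] have the same finite volume and the union already
    accounts for their sum. *)
Lemma volume_overlap (R : realType) d (G : set 'cV[R]_d) (e : 'cV[R]_d) :
  cV_measurable G -> (volume G < +oo)%E ->
  volume [set x | G x \/ G (x - e)] = (2%:E * volume G)%E ->
  volume (G `&` [set x | G (x - e)]) = 0%E.
Proof.
move=> mG Goo.
have mGe := cV_measurable_shift (- e) mG.
have Geoo : (volume [set x | G (x - e)%R] < +oo)%E by rewrite volume_shift.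
have mU : volume [set x | G x \/ G (x - e)] =
    (volume G + volume [set x | G (x - e)%R] -
     volume (G `&` [set x | G (x - e)%R]))%E.
  exact: (@measureUfinr _ _ _ (lebesgue_tuple R d) _ _ mG mGe Geoo).
rewrite mU volume_shift//.
have vG : volume G \is a fin_num by rewrite ge0_fin_numE//; exact: measure_ge0.
have vGe : volume (G `&` [set x | G (x - e)]) \is a fin_num.
  rewrite ge0_fin_numE; last exact: measure_ge0.
  apply: le_lt_trans Goo; exact: (@measureIl _ _ _ (lebesgue_tuple R d) _ _ mG mGe).
rewrite -(fineK vG) -(fineK vGe) -EFinN -!EFinD -EFinM => -[].
by move=> h; congr EFin; lra.
Qed.

(** * Integer translates of a self-similar set *)

Section Tiling.
Context (R : realType) (d : nat) (M : 'M[int]_d) (e : 'cV[int]_d).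
Variable G : set 'cV[R]_d.

Local Notation iv := (map_mx (intr : int -> R)).

Hypothesis mG : cV_measurable G.
Hypothesis Goo : (volume G < +oo)%E.
Hypothesis scale : forall A : set 'cV[R]_d, cV_measurable A ->
  (2%:E * volume [set x | A (iv M *m x)%R] = volume A)%E.
Hypothesis G_self : forall x, G x <-> G (iv M *m x) \/ G (iv M *m x - iv e).
Hypothesis digits : forall P : 'cV[int]_d -> Prop, P 0 ->
  (forall z c, c \in [:: -1; 0; 1] -> P z -> P (M *m z + c *: e)) ->
  forall z, P z.
Hypothesis G_cover : forall x, exists z : 'cV[int]_d, G (x - iv z).

Let overlap (z : 'cV[int]_d) := [set x : 'cV[R]_d | G x /\ G (x - iv z)].

Let overlap_measurable z : cV_measurable (overlap z).
Proof. exact: (measurableI _ _ mG (cV_measurable_shift (- iv z) mG)). Qed.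

Let volume_overlapN z : volume (overlap (- z)) = volume (overlap z).
Proof.
rewrite -[RHS](volume_shift (iv z))//; congr volume.
by apply/seteqP; split => x; rewrite /overlap/= map_mxN addrK opprK => -[].
Qed.

Let overlap_null z : z != 0 -> volume (overlap z) = 0%E.
Proof.
(* The walk towards [z] starts at 0, where the overlap is all of [G], and may return there. Hence
   [P] admits 0; a step out of 0 lands on [e], [- e] or 0. *)
pose P (z : 'cV[int]_d) := z = 0 \/ volume (overlap z) = 0%E.
(* [M x] lies in the union of [G] and [G + e] exactly when [x] lies in [G], so by [scale] that union
   has twice the volume of [G]. *)
have oe : volume (overlap e) = 0%E.
  apply: volume_overlap => //; rewrite -scale.
    congr (_ * volume _)%E; apply/seteqP; split => x /=;
      [exact: (G_self x).2|exact: (G_self x).1].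
  exact: (measurableU _ _ mG (cV_measurable_shift (- iv e) mG)).
suff : P z by case=> [->|//]; rewrite eqxx.
apply: digits => [|{}z c cD [->|zo]]; first by left.
  rewrite mulmx0 add0r; move: cD; rewrite !inE => /or3P[] /eqP ->.
  - by right; rewrite scaleN1r volume_overlapN.
  - by left; rewrite scale0r.
  - by right; rewrite scale1r.
right; set w := _ + _.
have wE : iv w = iv M *m iv z + (c%:~R : R) *: iv e.
  by apply/colP => i; rewrite !mxE rmorphD rmorphM rmorph_sum; congr (_ + _);
    apply: eq_bigr => j _; rewrite !mxE rmorphM.
(* Membership of [t] and of [t - z] in [G] is tested with digits whose difference is [c]: the pair
   is (1, 0) for [c = -1] and (0, [c]) otherwise. The shift [v] is minus the first digit times
   [e]. *)
pose v : 'cV[R]_d := if c == -1 then - iv e else 0.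
have mB : cV_measurable [set x | overlap w (x + v)].
  exact: cV_measurable_shift.
rewrite -(volume_shift v)// -scale// (_ : volume _ = 0%E) ?mule0//.
apply: (@subset_measure0 _ _ _ (lebesgue_tuple R d) _ _ _
  (overlap_measurable z)) => //.
- exact: (cV_measurable_linear (iv M) mB).
move=> t /=; rewrite /overlap/= wE /v.
move: cD; rewrite !inE => /or3P[] /eqP -> /=.
- rewrite scaleN1r => -[Ge Gz]; split; apply/G_self; first by right.
  by left; rewrite mulmxBr; move: Gz; rewrite opprD opprK addrACA addNr addr0.
- rewrite scale0r !addr0 => -[Ge Gz]; split; apply/G_self; first by left.
  by left; rewrite mulmxBr.
- rewrite scale1r addr0 => -[Ge Gz]; split; apply/G_self; first by left.
  by right; rewrite mulmxBr -addrA -opprD.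
Qed.

(** Cut [G] along the integer cells and translate the pieces into the unit cell. They fill it
    because the translates of [G] cover, and they overlap in null sets, so the volumes agree. *)
Lemma volume_tile : volume G = 1%E.
Proof.
(* Countable additivity is indexed by [nat]: integer vectors are enumerated by their codes, and a
   number that codes none contributes the empty set. *)
pose cell (f : 'cV[int]_d -> set 'cV[R]_d) k :=
  if pickle_inv k is Some z then f z else set0.
have cellU f : \bigcup_k cell f k = \bigcup_z f z.
  apply/seteqP; split => x [k _].
    by rewrite /cell; case: pickle_inv => // z fzx; exists z.
  by move=> fkx; exists (pickle k) => //; rewrite /cell pickleK_inv.
have cellI f j k : (j < k)%N ->
    (forall z w, z != w -> volume (f z `&` f w) = 0%E) ->
    volume (cell f k `&` cell f j) = 0%E.
  have v0 : volume (set0 : set 'cV[R]_d) = 0%E.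
    by rewrite /volume preimage_set0 measure0.
  move=> jk fI; rewrite /cell.
  have := pickle_invK (T := 'cV[int]_d) k.
  have := pickle_invK (T := 'cV[int]_d) j.
  case: pickle_inv => [w|]; last by rewrite setI0.
  case: pickle_inv => [z|]; last by rewrite set0I.
  move=> /= wj zk; apply: fI; apply/eqP => zw.
  by move: jk; rewrite -wj -zk zw ltnn.
have cell_measurable f k :
    (forall z, cV_measurable (f z)) -> cV_measurable (cell f k).
  rewrite /cell /cV_measurable => mf; case: pickle_inv => //.
  by rewrite preimage_set0.
have volU f : (forall z, cV_measurable (f z)) ->
    (forall z w, z != w -> volume (f z `&` f w) = 0%E) ->
    (volume (\bigcup_z f z) = \sum_(k <oo) volume (cell f k))%E.
  move=> mf fI; rewrite -cellU /volume preimage_bigcup.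
  apply: (measure_bigcup_overlap0 (mu := lebesgue_tuple R d)) => [k|j k jk].
    exact: cell_measurable.
  by rewrite -preimage_setI; exact: cellI.
(* [g z] is the piece of [G] in the cell at [z], and [f z] is that piece moved back by [z]. *)
pose f z : set 'cV[R]_d := [set x | unit_cell x /\ G (x + iv z)].
pose g z : set 'cV[R]_d := [set x | unit_cell (x - iv z) /\ G x].
have mf z : cV_measurable (f z).
  exact: (measurableI _ _ (@unit_cell_measurable R d)
    (cV_measurable_shift _ mG)).
have mg z : cV_measurable (g z).
  exact: (measurableI _ _
    (cV_measurable_shift _ (@unit_cell_measurable R d)) mG).
have fI z w : z != w -> volume (f z `&` f w) = 0%E.
  move=> zw.
  apply: (@subset_measure0 _ _ _ (lebesgue_tuple R d) _
    (@col_tuple R d @^-1` [set x | overlap (z - w) (x + iv z)])).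
  - exact: (measurableI _ _ (mf z) (mf w)).
  - exact: cV_measurable_shift.
  - move=> t [[_ Gz] [_ Gw]]; split => //=.
    by rewrite map_mxB opprB addrACA subrr addr0.
  rewrite -[LHS]/(volume [set x | overlap (z - w) (x + iv z)]) volume_shift//.
  by rewrite overlap_null// subr_eq0.
have gI z w : z != w -> volume (g z `&` g w) = 0%E.
  move=> zw; rewrite (_ : _ `&` _ = set0) /volume ?preimage_set0 ?measure0//.
  apply/seteqP; split => // x [[xz _] [xw _]]; move/eqP: zw; apply.
  apply/colP => i; have := xz i; have := xw i; rewrite !mxE.
  move=> /andP[xw0 xw1] /andP[xz0 xz1].
  have zw1 : (z i 0)%:~R < (w i 0 + 1)%:~R :> R by rewrite intrD; lra.
  have wz1 : (w i 0)%:~R < (z i 0 + 1)%:~R :> R by rewrite intrD; lra.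
  by move: zw1 wz1; rewrite !ltr_int !ltzD1 => zw wz; apply/le_anti; rewrite zw.
have -> : G = \bigcup_z g z.
  apply/seteqP; split => [x Gx|x [z _ []//]].
  exists (\col_i Num.floor (x i 0)) => //; split => // i.
  have /andP[f0 f1] := floor_itv (x i 0); move: f1; rewrite intrD => f1.
  by rewrite !mxE; apply/andP; split; lra.
rewrite volU//.
under eq_eseriesr => k _.
  rewrite (_ : volume _ = volume (cell f k)); first over.
  rewrite /cell; case: pickle_inv => [z|//].
  rewrite -(volume_shift (iv z)) => //; congr volume.
  by apply/seteqP; split => x; rewrite /f /g /= addrK.
rewrite -volU// -(@volume_unit_cell R d); congr volume.
apply/seteqP; split => [x [z _ []//]|x cx].
by have [z Gz] := G_cover x; exists (- z) => //; split => //; rewrite map_mxN.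
Qed.

End Tiling.

(** * The attractor as the set of points with a bounded orbit *)

Section MatrixNorm.
Context (R : realType).

Definition mxnorm1 m n (A : 'M[R]_(m, n)) : R := \sum_i \sum_j (`|A i j| : R).

Lemma mxnorm1_ge0 m n (A : 'M[R]_(m, n)) : 0 <= mxnorm1 A.
Proof. by apply: sumr_ge0 => i _; exact: sumr_ge0. Qed.

Lemma ler_term_sum (I : finType) (F : I -> R) j :
  (forall i, 0 <= F i) -> F j <= \sum_i F i.
Proof. by move=> F0; rewrite (bigD1 j)//= lerDl sumr_ge0. Qed.

Lemma mxnorm1_mul m n q (A : 'M[R]_(m, n)) (B : 'M[R]_(n, q)) :
  mxnorm1 (A *m B) <= mxnorm1 A * mxnorm1 B.
Proof.
rewrite [X in X * _]/mxnorm1 mulr_suml; apply: ler_sum => i _.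
apply: (@le_trans _ _ (\sum_l \sum_j (`|A i j| * `|B j l| : R))).
  apply: ler_sum => l _; rewrite mxE (le_trans (ler_norm_sum _ _ _))//.
  by apply: ler_sum => j _; rewrite normrM.
rewrite exchange_big mulr_suml /=; apply: ler_sum => j _.
rewrite -mulr_sumr ler_wpM2l//.
apply: (ler_term_sum (F := fun j => \sum_l (`|B j l| : R))) => k.
exact: sumr_ge0.
Qed.

Lemma cube_mulmx n (A : 'M[R]_n) K x :
  cube K x -> cube (mxnorm1 A * K) (A *m x).
Proof.
move=> Kx i; rewrite mxE (le_trans (ler_norm_sum _ _ _))//.
have K0 : 0 <= K by rewrite (le_trans _ (Kx i)).
apply: (@le_trans _ _ (\sum_j (`|A i j| * K : R))).
  by apply: ler_sum => j _; rewrite normrM ler_wpM2l.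
rewrite -mulr_suml ler_wpM2r//.
apply: (ler_term_sum (F := fun i => \sum_j (`|A i j| : R))) => k.
exact: sumr_ge0.
Qed.

Lemma cube_mxnorm1 n (x : 'cV[R]_n) : cube (mxnorm1 x) x.
Proof.
move=> i; apply: le_trans (ler_term_sum (F := fun i => \sum_j (`|x i j| : R)) i _).
  by rewrite big_ord1.
by move=> k; exact: sumr_ge0.
Qed.

Lemma cubeD n K L (x y : 'cV[R]_n) : cube K x -> cube L y -> cube (K + L) (x + y).
Proof.
move=> Kx Ly i; rewrite mxE (le_trans (ler_normD _ _))//.
exact: lerD.
Qed.

Lemma le_cube n K L (x : 'cV[R]_n) : K <= L -> cube K x -> cube L x.
Proof. by move=> KL Kx i; exact: le_trans (Kx i) KL. Qed.

Lemma cvg_mx m n (u : nat -> 'M[R]_(m, n)) (x : 'M[R]_(m, n)) :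
  (forall i j, (fun k => u k i j) @ \oo --> x i j) -> u @ \oo --> x.
Proof.
move=> ux A [P xP PA].
have N i j : {N | forall k, (N <= k)%N -> P i j (u k i j)}.
  by apply: cid; have [N _ NP] := ux i j _ (xP i j); exists N => k; exact: NP.
exists (\max_i \max_j sval (N i j)) => // k /= Nk; apply: PA => i j.
apply: (svalP (N i j)); apply: leq_trans Nk.
apply: leq_trans (leq_bigmax i); exact: leq_bigmax.
Qed.

End MatrixNorm.

Section Attractor.
Context (R : realType) (d : nat) (M : 'M[int]_d) (e : 'cV[int]_d).

Local Notation iv := (map_mx (intr : int -> R)).
Local Notation Mr := (iv M).
Local Notation V := (invmx Mr).
Local Notation G := (attractor Mr [set 0%R; iv e]).

Variable C : R.
Hypothesis M_unit : Mr \in unitmx.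
Hypothesis e_cube : cube 1 (iv e).
Hypothesis decay : forall n, \sum_(i < n) mxnorm1 (V ^+ i) <= C.

Definition digit_step (b : bool) (x : 'cV[R]_d) := Mr *m x - b%:R *: iv e.

(** The [n]-th point is [Mr ^+ n] applied to what remains of [x] after its first [n] expansion
    terms. Digits are indexed from 0 here, from 1 in [attractor]. *)
Fixpoint orbit (a : nat -> bool) (x : 'cV[R]_d) n :=
  if n is n'.+1 then digit_step (a n') (orbit a x n') else x.

Lemma expmx_invmxK n (y : 'cV[R]_d) : Mr ^+ n *m (V ^+ n *m y) = y.
Proof.
elim: n y => [|n IH] y; first by rewrite !expr0 !mul1mx.
rewrite exprSr exprS -[X in X *m _]/(Mr ^+ n *m Mr).
by rewrite -[X in _ *m (X *m _)]/(V *m V ^+ n) -!mulmxA mulKVmx.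
Qed.

Lemma orbitS a x n : orbit a x n.+1 = orbit (a \o succn) (digit_step (a 0%N) x) n.
Proof. by elim: n => //= n <-. Qed.

Lemma orbit_backward a x k j :
  orbit a x k = V ^+ j *m orbit a x (k + j) +
    \sum_(i < j) V ^+ i.+1 *m ((a (k + i)%N)%:R *: iv e).
Proof.
elim: j => [|j IH]; first by rewrite addn0 expr0 mul1mx big_ord0 addr0.
rewrite IH big_ord_recr /= addnS /= [RHS]addrCA addrC; congr (_ + _).
rewrite -mulmxDr /digit_step subrK exprSr -[X in _ = X *m _]/(V ^+ j *m V).
by rewrite -mulmxA mulKmx.
Qed.

Lemma decay_sum_cube (a : nat -> bool) j :
  cube C (\sum_(i < j) V ^+ i.+1 *m ((a i)%:R *: iv e)).
Proof.
apply: (@le_cube _ _ (\sum_(i < j) mxnorm1 (V ^+ i.+1))).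
  have := decay j.+1; rewrite big_ord_recl; apply: le_trans.
  by rewrite lerDr mxnorm1_ge0.
elim: j => [|j IH]; first by rewrite !big_ord0 => i; rewrite mxE normr0.
rewrite !big_ord_recr /=; apply: cubeD => //.
rewrite -[X in cube X]mulr1; apply: cube_mulmx => i; rewrite mxE normrM.
by case: (a j); rewrite ?normr1 ?normr0 ?mul1r ?mul0r//; exact: e_cube.
Qed.

Lemma decay_cvg0 : (fun n => mxnorm1 (V ^+ n)) @ \oo --> 0.
Proof.
apply: cvg_series_cvg_0; apply: nondecreasing_is_cvgn.
  by apply: nondecreasing_series => n _ _; exact: mxnorm1_ge0.
by exists C => _ [n _ <-]; rewrite /series/= big_mkord.
Qed.

(** Orbit points of an expansion are its rescaled tails, which [C] bounds; conversely, a bounded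
    orbit makes the remainder [V ^+ n *m orbit a x n] vanish in the limit. The freedom in [K] lets
    the radius be enlarged at will. *)
Lemma attractor_orbit K x : C <= K ->
  G x <-> exists a, forall n, cube K (orbit a x n).
Proof.
move=> CK; split => [[a [aD ax]]|[a aK]].
  have /choice[b bE] n : exists b : bool, a n.+1 = b%:R *: iv e.
    have [->|->] := aD n.+1; first by exists false; rewrite scale0r.
    by exists true; rewrite scale1r.
  exists b => n; apply: (le_cube CK) => i.
  pose S n := \sum_(1 <= k < n) (V ^+ k *m a k).
  have SE m : S m.+1 = \sum_(k < m) V ^+ k.+1 *m ((b k)%:R *: iv e).
    by rewrite /S big_add1 big_mkord; apply: eq_bigr => k _; rewrite bE.
  have orbE y m : orbit b y m = Mr ^+ m *m (y - S m.+1).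
    rewrite [y in RHS](orbit_backward b y 0 m) add0n SE addrK.
    by rewrite expmx_invmxK.
  (* The orbit of the partial sum with [n + m] terms is 0 at time [n + m], so its [n]-th point is a
     finite tail. The bound survives the limit in [m]. *)
  have orbC m : cube C (Mr ^+ n *m (S (n + m).+1 - S n.+1)).
    rewrite -orbE (orbit_backward b _ n m) orbE subrr !mulmx0 add0r.
    exact: (decay_sum_cube (fun k => b (n + k)%N)).
  rewrite orbE.
  have Scvg : (fun m => (Mr ^+ n *m (S (n + m).+1 - S n.+1)) i 0) @ \oo -->
      (Mr ^+ n *m (x - S n.+1)) i 0.
    rewrite mxE; under eq_fun do rewrite mxE.
    apply: cvg_big => [|j _]; first exact: add_continuous.
    apply: cvgM; first exact: cvg_cst.
    rewrite !mxE; under eq_fun do rewrite !mxE.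
    apply: cvgB; last exact: cvg_cst.
    have Sj : (fun m => S m j 0) @ \oo --> x j 0.
      exact: (cvg_comp _ _ ax (@coord_continuous R d 1 j 0 x)).
    move: Sj; rewrite -(cvg_shiftn n.+1); apply: cvg_trans; apply: near_eq_cvg.
    by near=> m; rewrite /= addnS addnC.
  apply: (cvgr_to_le (cvg_norm Scvg)).
  by near=> m; exact: orbC.
exists (fun k => (a k.-1)%:R *: iv e); split.
  by move=> k; case: (a _); rewrite ?scale1r ?scale0r; [right|left].
apply/cvg_mx => i j; rewrite ord1 => {j}.
rewrite -(cvg_shiftS _); apply/cvgrPdist_le => eps eps0.
have K1 : 0 < `|K| + 1 by rewrite ltr_wpDl.
have /cvgrPdist_le /(_ _ (divr_gt0 eps0 K1)) := decay_cvg0.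
apply: filterS => n; rewrite sub0r normrN ger0_norm ?mxnorm1_ge0// => Vn.
rewrite /= big_add1 big_mkord.
have := orbit_backward a x 0 n; rewrite add0n /= => xE.
have -> : x i 0 - (\sum_(k < n) V ^+ k.+1 *m ((a k)%:R *: iv e)) i 0 =
    (V ^+ n *m orbit a x n) i 0.
  by rewrite {1}xE mxE addrK.
apply: le_trans (cube_mulmx _ (aK n) i) _.
apply: (@le_trans _ _ (mxnorm1 (V ^+ n) * (`|K| + 1))).
  by rewrite ler_wpM2l ?mxnorm1_ge0// (le_trans (ler_norm _))// lerDl.
by rewrite -ler_pdivlMr.
Unshelve. all: by end_near.
Qed.

Variable K : R.
Hypothesis CK : 2 * C <= K.

Let C_ge0 : 0 <= C.
Proof. by have := decay 0; rewrite big_ord0. Qed.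

Let C_le_K : C <= K.
Proof. by apply: le_trans CK; rewrite ler_peMl// ler1n. Qed.

(** Bounded orbits up to depth [n]. Each depth is measurable by induction, which exhibits the
    attractor, defined through infinite digit sequences, as a countable intersection of measurable
    sets. *)
Fixpoint good n x : Prop :=
  if n is n'.+1 then cube K x /\ exists b, good n' (digit_step b x)
  else cube K x.

Lemma goodS n x : good n.+1 x -> good n x.
Proof.
elim: n x => [|n IH] x /= [Kx [b gb]]; first by [].
by split=> //; exists b; exact: IH.
Qed.

Lemma le_good m n x : (m <= n)%N -> good n x -> good m x.
Proof.
by move=> /subnK <-; elim: (n - m)%N => //= k IH /goodS.
Qed.

Lemma orbit_good a x n : (forall k, (k <= n)%N -> cube K (orbit a x k)) -> good n x.
Proof.
elim: n a x => [|n IH] a x aK; first exact: (aK 0%N).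
split; first exact: (aK 0%N).
exists (a 0%N); apply: (IH (a \o succn)) => k kn.
by rewrite -orbitS; exact: aK.
Qed.

Lemma attractor_good x :
  G x <-> forall n, good n x.
Proof.
rewrite (attractor_orbit x C_le_K).
split=> [[a aK] n|gx]; first by apply: (orbit_good (a := a)).
(* Koenig's lemma for the binary tree of digits *)
have next y : (forall n, good n y) -> exists b, forall n, good n (digit_step b y).
  move=> gy; apply/not_existsP => H.
  have /existsNP[n0 g0] := H false; have /existsNP[n1 g1] := H true.
  have [_ [[] gb]] := gy (maxn n0 n1).+1.
    by apply: g1; apply: le_good gb; exact: leq_maxr.
  by apply: g0; apply: le_good gb; exact: leq_maxl.
have /choice[f fP] y :
    exists b, (forall n, good n y) -> forall n, good n (digit_step b y).
  have [gy|ngy] := pselect (forall n, good n y); last by exists true => /ngy.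
  by have [b] := next y gy; exists b.
pose y := fix y n := if n is n'.+1 then digit_step (f (y n')) (y n') else x.
exists (f \o y) => n.
have -> : orbit (f \o y) x n = y n by elim: n => //= n ->.
have gy k : good k (y n) by elim: n k => //= n IH; exact: fP.
exact: (gy 0%N).
Qed.

Lemma good_measurable n : cV_measurable (good n : set 'cV[R]_d).
Proof.
elim: n => [|n IH]; first exact: cube_measurable.
have step_measurable b : cV_measurable [set x | good n (digit_step b x)].
  exact: cV_measurable_affine.
have := measurableI _ _ (@cube_measurable R d K)
  (measurableU _ _ (step_measurable false) (step_measurable true)).
congr (measurable _); apply/seteqP; split => t /=.
  by move=> [Kt [gt|gt]]; split => //; [exists false|exists true].
by move=> [Kt [[] gt]]; split => //; [right|left].
Qed.

Lemma attractorE : G = \bigcap_n [set x | good n x].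
Proof.
apply/seteqP; split => x; first by move=> /attractor_good gx n _; exact: gx.
by move=> gx; apply/attractor_good => n; exact: gx.
Qed.

Lemma attractor_measurable : cV_measurable (G).
Proof.
rewrite attractorE /cV_measurable preimage_bigcap.
by apply: bigcapT_measurable => n; exact: good_measurable.
Qed.

Lemma volume_attractor_fin : (volume (G) < +oo)%E.
Proof.
apply: le_lt_trans (volume_cube_fin d K).
apply: le_measure; rewrite ?inE.
- exact: attractor_measurable.
- exact: cube_measurable.
by move=> t /attractor_good/(_ 0%N).
Qed.

Lemma attractor_self x : G x <->
  G (Mr *m x) \/ G (Mr *m x - iv e).
Proof.
split.
  move=> /(attractor_orbit _ C_le_K)[a aK].
  have aS : forall n, cube K (orbit (a \o succn) (digit_step (a 0%N) x) n).
    by move=> n; rewrite -orbitS.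
  move: aS; rewrite /digit_step.
  case: (a 0%N); rewrite ?scale1r ?scale0r ?subr0 => aS; [right|left];
    by apply/(attractor_orbit _ C_le_K); exists (a \o succn).
(* The orbit gains [x] as a new initial point, not yet known to lie in the cube of radius [K]; the
   larger radius includes it and characterises the same set. *)
pose L := K + mxnorm1 x.
have xL : cube L x.
  apply: (@le_cube _ _ (mxnorm1 x)); last exact: cube_mxnorm1.
  by rewrite /L lerDr; exact: le_trans C_le_K.
have KL : K <= L by rewrite /L lerDl mxnorm1_ge0.
move=> xG; have [b] : exists b, G (digit_step b x).
  by case: xG => xG; [exists false|exists true];
    rewrite /digit_step ?scale0r ?subr0 ?scale1r.
move=> /(attractor_orbit _ C_le_K)[a aK].
apply/(attractor_orbit _ (le_trans C_le_K KL)).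
exists (fun n => if n is n'.+1 then a n' else b) => -[|n]; first exact: xL.
by rewrite orbitS; apply: le_cube KL _; exact: aK.
Qed.

Hypothesis digit_exists : forall z : 'cV[int]_d,
  exists (b : bool) z', z = M *m z' + b%:R *: e.

(* Expanding the integer part of [M^n x] in base [M] yields, for every n, an
   integer translate of x in [good n]; one translate serves infinitely many n. *)
Lemma attractor_cover x : exists z : 'cV[int]_d, G (x - iv z).
Proof.
have back n (z : 'cV[int]_d) : exists z' a,
    orbit a (x - iv z') n = Mr ^+ n *m x - iv z.
  elim: n z => [|n IH] z; first by exists z, (fun=> true); rewrite expr0 mul1mx.
  have [b [z1 zE]] := digit_exists z.
  have [z' [a aE]] := IH z1.
  exists z', (fun k => if k == n then b else a k) => /=.
  have orbit_eq k : (k <= n)%N ->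
      orbit (fun k => if k == n then b else a k) (x - iv z') k =
      orbit a (x - iv z') k.
    by elim: k => //= k IHk kn; rewrite IHk 1?ltnW// ltn_eqF.
  rewrite orbit_eq//.
  rewrite aE eqxx /digit_step zE mulmxBr map_mxD map_mxM /= exprS opprD addrA.
  congr (_ - _ - _); first by rewrite -mulmxA.
  by apply/colP => i; rewrite !mxE rmorphM; case: (b); rewrite ?rmorph1 ?rmorph0.
have goodz n : exists z, good n (x - iv z).
  have [z [a aE]] := back n (\col_i Num.floor ((Mr ^+ n *m x) i 0)).
  exists z; apply: (orbit_good (a := a)) => k kn.
  rewrite (orbit_backward _ _ k (n - k)) subnKC// aE.
  (* One [C] bounds the contracted fractional part of [M^n x], the other the digit sum; hence the
     requirement [2 * C <= K]. *)
  apply: (@le_cube _ _ (C * 1 + C)); first by rewrite mulr1 -mulr2n -mulr_natl.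
  apply: cubeD; last exact: (decay_sum_cube (fun i => a (k + i)%N)).
  apply: (@le_cube _ _ (mxnorm1 (V ^+ (n - k)) * 1)).
    rewrite !mulr1; apply: le_trans (decay (n - k).+1); rewrite big_ord_recr /= lerDr.
    by apply: sumr_ge0 => i _; exact: mxnorm1_ge0.
  apply: cube_mulmx => i; rewrite !mxE.
  have /andP[f0 f1] := floor_itv ((Mr ^+ n *m x) i 0); move: f0 f1.
  rewrite !mxE intrD => f0 f1.
  by rewrite ler_norml; apply/andP; split; lra.
apply/not_existsP => noz.
have /choice[N NP] z : exists n, ~ good n (x - iv z).
  by apply/existsNP => gz; apply: (noz z); apply/attractor_good.
(* Only vectors [z] with entries of modulus at most [L] keep [x - z] in the cube, and [zu] lists
   them. If each failed at a depth [N z], the largest of these finitely many depths would contradict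
   [goodz]. *)
pose L := Num.bound (K + mxnorm1 x).
pose zu (u : {ffun 'I_d -> 'I_(L + L).+1}) : 'cV[int]_d := \col_i ((u i)%:Z - L%:Z).
have [z gz] := goodz (\max_u N (zu u)).
have Kz : cube K (x - iv z) by exact: (le_good (leq0n _) gz).
have [u zE] : exists u, z = zu u.
  have zL i : (`|z i 0| <= L%:Z)%R.
    have K0 : 0 <= K + mxnorm1 x.
      by rewrite addr_ge0 ?mxnorm1_ge0//; exact: le_trans C_le_K.
    rewrite -(ler_int R) intr_norm -pmulrn; apply: ltW.
    apply: le_lt_trans (archi_boundP K0).
    have := Kz i; have := cube_mxnorm1 x i; rewrite !mxE => xi xzi.
    rewrite -[X in `|X|](subrK (x i 0)) (le_trans (ler_normD _ _))//.
    by rewrite lerD// distrC.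
  exists [ffun i => inord (absz (z i 0 + L%:Z))]; apply/colP => i; rewrite mxE ffunE.
  have := zL i => zLi.
  by rewrite inordK; lia.
apply: (NP z); apply: le_good gz; rewrite {1}zE; exact: leq_bigmax.
Qed.
End Attractor.

(** * Expansions with digits -1, 0 and 1 *)

Definition digit_poly (f : {poly int}) := forall i, f`_i \in [:: -1; 0; 1].

Definition digit_representable (q g : {poly int}) :=
  exists f h, digit_poly f /\ g = f + h * q.

Lemma digit_polyC c : c \in [:: -1; 0; 1] -> digit_poly c%:P.
Proof. by move=> cD i; rewrite coefC; case: ifP. Qed.

Lemma digit_polyMXaddC f c :
  digit_poly (f * 'X + c%:P) <-> digit_poly f /\ c \in [:: -1; 0; 1].
Proof.
split=> [fD|[fD cD] i]; last first.
  by rewrite coefD coefMX coefC; case: i => [|i]; rewrite ?add0r ?addr0.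
split=> [i|]; first by have := fD i.+1; rewrite coefD coefMX coefC addr0.
by have := fD 0%N; rewrite coefD coefMX coefC add0r.
Qed.

Lemma digit_polyN f : digit_poly f -> digit_poly (- f).
Proof.
by move=> fD i; rewrite coefN; have := fD i; rewrite !inE => /or3P[] /eqP ->.
Qed.

Lemma digit_small (c : int) : `|c| <= 1 -> c \in [:: -1; 0; 1].
Proof. by move=> c1; rewrite !inE; case: c c1 => [[|[|]]|[|]]. Qed.

(** Modulo [X + c], the number [u = b + c u'] is congruent to [b - u' X], and [u'] is smaller than
    [u] in modulus once [|u| >= 2]. *)
Lemma digit_representable_linear (c u : int) : c = 2 \/ c = - 2 ->
  digit_representable ('X + c%:P) u%:P.
Proof.
move=> c2; have [n] := ubnP `|u|%N; elim: n u => // n IH u un.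
have [u1|u1] := leqP `|u|%N 1.
  exists u%:P, 0; rewrite mul0r addr0; split => //; apply: digit_polyC.
  by apply: digit_small; lia.
pose b : int := (u %% 2)%Z.
have [u' u'E] : exists u', u = b + c * u'.
  have := divz_eq u 2; rewrite -/b; move: b (u %/ 2)%Z => b k uE.
  by case: c2 => ->; [exists k|exists (- k)]; lia.
have b01 : b = 0 \/ b = 1.
  have := @modz_ge0 u 2 isT; have := @ltz_pmod u 2 isT; rewrite -/b; lia.
have [|f [h [fD fE]]] := IH u'.
  by case: c2 u'E => ->; lia.
exists ((- f) * 'X + b%:P), (u'%:P - h * 'X); split.
  apply/digit_polyMXaddC; split; first exact: digit_polyN.
  by case: b01 => ->.
rewrite {1}u'E polyCD polyCM fE; ring.
Qed.

(** [N u v] is the norm of [u + v X] modulo the quadratic, positive definite since [a^2 < 8].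
    Removing a suitable digit adds at most 1 to it and dividing by [X] halves it, so it decreases as
    long as it is at least 2. *)
Lemma digit_representable_quadratic (a u v : int) : `|a| <= 2 ->
  digit_representable ('X^2 + a%:P * 'X + 2%:P) (v%:P * 'X + u%:P).
Proof.
move=> a2; pose N (u v : int) := u ^+ 2 - a * u * v + 2 * v ^+ 2.
have a28 : a ^+ 2 <= 4 by nia.
have Nu x y : 4 * x ^+ 2 <= 8 * N x y.
  have : 0 <= (4 * y - a * x) ^+ 2 by exact: sqr_ge0.
  rewrite /N; nia.
have Nv x y : 4 * y ^+ 2 <= 4 * N x y.
  have : 0 <= (2 * x - a * y) ^+ 2 by exact: sqr_ge0.
  rewrite /N; nia.
have [n] := ubnP `|N u v|%N; elim: n u v => // n IH u v un.
have [uv1|uv1] := boolP ((`|u| <= 1) && (`|v| <= 1)).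
  exists (v%:P * 'X + u%:P), 0; rewrite mul0r addr0; split => //.
  move/andP: uv1 => [u1 v1]; apply/digit_polyMXaddC; split; last exact: digit_small.
  by apply: digit_polyC; exact: digit_small.
have N2 : 2 <= N u v.
  by move: uv1 (Nu u v) (Nv u v); rewrite negb_and => /orP[]; nia.
(* For odd [u], one of the digits 1 and -1 raises the norm by at most 1. *)
have [s [k [sD usk Nk]]] : exists s k : int,
    [/\ s \in [:: -1; 0; 1], u = s + 2 * k & N (2 * k) v <= N u v + 1].
  pose b : int := (u %% 2)%Z; pose k := (u %/ 2)%Z.
  have uE : u = b + 2 * k by rewrite addrC mulrC; exact: divz_eq.
  have b01 : b = 0 \/ b = 1.
    have := @modz_ge0 u 2 isT; have := @ltz_pmod u 2 isT; rewrite -/b; lia.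
  case: b01 => b01.
    exists 0, k; split => //; first by rewrite uE b01.
    have -> : 2 * k = u by rewrite uE b01 add0r.
    lia.
  have [s0|s0] := lerP 0 (2 * u - a * v).
    exists 1, k; split => //; first by rewrite uE b01.
    have -> : 2 * k = u - 1 by rewrite uE b01; lia.
    rewrite /N; nia.
  exists (-1), (k + 1); split => //; first by rewrite uE b01; lia.
  have -> : 2 * (k + 1) = u + 1 by rewrite uE b01; lia.
  rewrite /N; nia.
(* Modulo q, [2 k + v X = X z] with [z = (v - a k) - k X]. *)
have Nhalf : N (2 * k) v = 2 * N (v - a * k) (- k) by rewrite /N; ring.
have N0 : 0 <= N (v - a * k) (- k).
  by have := Nv (v - a * k) (- k); have := sqr_ge0 (- k); lia.
have [|f [h [fD fE]]] := IH (v - a * k) (- k); first by lia.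
exists (f * 'X + s%:P), (k%:P + h * 'X); split; first exact/digit_polyMXaddC.
rewrite {1}usk polyCD polyCM.
have -> : f = (- k)%:P * 'X + (v - a * k)%:P - h * ('X^2 + a%:P * 'X + 2%:P).
  by rewrite fE addrK.
rewrite polyCB polyCM polyCN; ring.
Qed.

Lemma digit_representable_rmodp (q g : {poly int}) : q \is monic ->
  digit_representable q (Pdiv.Ring.rmodp g q) -> digit_representable q g.
Proof.
move=> qm [f [h [fD fE]]]; exists f, (h + Pdiv.Ring.rdivp g q); split => //.
by rewrite {1}(Pdiv.RingMonic.rdivp_eq qm g) fE; ring.
Qed.

Section Interleave.
Variables (R : comNzRingType) (m : nat).
Hypothesis m0 : (0 < m)%N.

(** [F j] carries the coefficients at exponents congruent to [j] modulo [m]. *)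
Definition interleave (F : nat -> {poly R}) :=
  \sum_(j < m) 'X^j * (F j \Po 'X^m).

Lemma coef_interleave F i : (interleave F)`_i = (F (i %% m)%N)`_(i %/ m).
Proof.
rewrite coef_sum (bigD1 (Ordinal (ltn_pmod i m0)))//= big1 => [|j ji].
  rewrite addr0 coefXnM ltnNge leq_mod/= coef_comp_poly_Xn//.
  have -> : (i - i %% m = i %/ m * m)%N by rewrite {1}(divn_eq i m) addnK.
  by rewrite dvdn_mull// mulnK.
rewrite coefXnM; case: ltnP => // ij; rewrite coef_comp_poly_Xn//.
case: ifP => // /dvdnP[k kE].
suff : j = Ordinal (ltn_pmod i m0) by move/eqP: ji.
by apply: val_inj; rewrite /= -(subnK ij) kE modnMDl modn_small.
Qed.

Lemma interleave_surj (g : {poly R}) :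
  g = interleave (fun j => \poly_(k < size g) g`_(k * m + j)).
Proof.
apply/polyP => i; rewrite coef_interleave coef_poly -divn_eq.
case: ltnP => // gi; rewrite nth_default//.
by apply: leq_trans gi _; exact: leq_div.
Qed.
End Interleave.

(** Multiplication by a polynomial in [X^m] preserves residue classes of exponents, so each class is
    reduced modulo [q] on its own and the digits are interleaved. *)
Lemma digit_representable_comp (m : nat) (q g : {poly int}) : (0 < m)%N ->
  (forall g, digit_representable q g) -> digit_representable (q \Po 'X^m) g.
Proof.
move=> m0 qD; rewrite (interleave_surj m0 g).
set G := fun j => _.
have /choice[F] j : exists F : {poly int} * {poly int},
  digit_poly F.1 /\ G j = F.1 + F.2 * q.
  by have [f [h fh]] := qD (G j); exists (f, h).
move=> FE; exists (interleave m (fun j => (F j).1)).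
exists (interleave m (fun j => (F j).2)).
split; first by move=> i; rewrite coef_interleave//; exact: (FE _).1.
rewrite /interleave mulr_suml -big_split/=; apply: eq_bigr => j _.
by rewrite (FE j).2 comp_polyD comp_polyM; ring.
Qed.

Lemma digit_representable_monic_linear (c : int) g : c = 2 \/ c = - 2 ->
  digit_representable ('X + c%:P) g.
Proof.
move=> c2; apply: digit_representable_rmodp; first exact: monicXaddC.
have := @Pdiv.Ring.ltn_rmodpN0 _ g ('X + c%:P) (monic_neq0 (monicXaddC c)).
rewrite size_XaddC ltnS => /size1_polyC ->.
exact: digit_representable_linear.
Qed.

Lemma digit_representable_monic_quadratic (a : int) g : `|a| <= 2 ->
  digit_representable ('X^2 + a%:P * 'X + 2%:P) g.
Proof.
move=> a2; set q := 'X^2 + _ + _.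
have qE : q = 'X^2 + (a%:P * 'X + 2%:P) by rewrite /q addrA.
have s2 : (size ((a%:P * 'X + 2%:P)%R : {poly int}) < size ('X^2 : {poly int}))%N.
  rewrite size_polyXn ltnS (leq_trans (size_polyD _ _))// geq_max.
  rewrite (leq_trans (size_polyMleq _ _)) ?size_polyX ?addn2 ?ltnS ?size_polyC_leq1//.
  by rewrite (leq_trans (size_polyC_leq1 _)).
have qm : q \is monic by rewrite qE monicE lead_coefDl// lead_coefXn.
apply: digit_representable_rmodp => //.
have := @Pdiv.Ring.ltn_rmodpN0 _ g q (monic_neq0 qm).
rewrite {2}qE size_polyDl// size_polyXn ltnS.
move: (Pdiv.Ring.rmodp g q) => r r2.
have -> : r = (r`_1)%:P * 'X + (r`_0)%:P.
  apply/polyP => -[|[|i]]; rewrite coefD coefMX !coefC ?add0r ?addr0//=.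
  by rewrite nth_default// (leq_trans r2).
exact: digit_representable_quadratic.
Qed.

(** * Isotropic polynomials *)

Section Isotropic.
Context (C : numClosedFieldType).

Lemma coef_prod_conj (s : seq C) rho : (forall x, x \in s -> x * x^* = rho) ->
  forall i j, (i + j)%N = size s ->
  (\prod_(x <- s) ('X - x%:P))`_i * rho ^+ i =
  (\prod_(x <- s) ('X - x%:P))`_0 * (\prod_(x <- s) ('X - (x^* )%:P))`_j.
Proof.
elim: s => [|x s IH] xs i j ij.
  have [-> ->] : i = 0%N /\ j = 0%N by move: ij => /=; lia.
  by rewrite !big_nil coef1 !mulr1.
have xrho : x * x^* = rho by apply: xs; rewrite mem_head.
have {}IH := IH (fun y ys => xs y (mem_behead (s := x :: s) ys)).
rewrite !big_cons.
set A := \prod_(y <- s) _ in IH *; set B := \prod_(y <- s) _ in IH *.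
have sA : size A = (size s).+1 by rewrite size_prod_XsubC.
have sB : size B = (size s).+1.
  rewrite /B -(big_map (fun y => y^*) xpredT (fun y => 'X - y%:P)).
  by rewrite size_prod_XsubC size_map.
rewrite !mulrBl !coefB !coefXM !coefCM eqxx sub0r.
case: i j ij => [|i] [|j] //= ij.
- have j_s : j = size s by lia.
  rewrite sub0r expr0 mulr1 [B`_j.+1]nth_default ?sB ?j_s// mulr0 subr0.
  have := IH 0%N (size s) (add0n _); rewrite expr0 mulr1 => A0.
  by rewrite mulNr -mulrA -A0.
- have i_s : i = size s by lia.
  rewrite [A`_i.+1]nth_default ?sA ?i_s// mulr0 subr0 exprSr mulrA.
  rewrite (IH (size s) 0%N (addn0 _)) sub0r -xrho; ring.
- have e1 : (i + j.+1 = size s)%N by lia.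
  have e2 : (i.+1 + j = size s)%N by lia.
  transitivity (A`_i * rho ^+ i * rho - x * (A`_i.+1 * rho ^+ i.+1)).
    by rewrite exprS; ring.
  by rewrite (IH _ _ e1) (IH _ _ e2) -xrho; ring.
Qed.

Lemma isotropic_coef_symmetry (p : {poly int}) :
  p \is monic -> (1 < size p)%N -> 
  (forall z w : C, root (map_poly intr p) z -> root (map_poly intr p) w ->
    `|z| = `|w|) ->
  exists rho : C, [/\ 0 <= rho,
    exists2 x : C, root (map_poly intr p) x & `|x| ^+ 2 = rho &
    forall i j, (i + j)%N = (size p).-1 ->
      (p`_i)%:~R * rho ^+ i = (p`_0)%:~R * (p`_j)%:~R :> C].
Proof.
move=> pm p1 iso; set P := map_poly intr p in iso *.
have Pm : P \is monic by exact: monic_map.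
have sP : size P = size p by rewrite size_map_poly_id0// (monicP pm) oner_neq0.
have [s Ps] := closed_field_poly_normal P.
rewrite (monicP Pm) scale1r in Ps.
have ss : size s = (size p).-1 by rewrite -sP Ps size_prod_XsubC.
have [x xs] : exists x, x \in s.
  case: s ss {Ps} => [|x s] /=; first by case: (size p) p1 => [|[|]].
  by exists x; rewrite mem_head.
have rootP y : y \in s -> root P y by rewrite Ps root_prod_XsubC.
exists (`|x| ^+ 2); split; [exact: exprn_ge0|by exists x => //; exact: rootP|].
move=> i j ij; rewrite -ss in ij.
(* Integer coefficients are fixed by conjugation, so the conjugate roots give the same
   polynomial. *)
have conjP : \prod_(y <- s) ('X - (y^* )%:P) = P.
  transitivity (map_poly Num.conj P).
    rewrite {1}Ps rmorph_prod; apply: eq_bigr => y _.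
    by rewrite rmorphB /= map_polyX map_polyC.
  by rewrite /P -map_poly_comp; apply: eq_map_poly => z /=; rewrite rmorph_int.
have := coef_prod_conj (s := s) (rho := `|x| ^+ 2) _ ij.
rewrite -Ps conjP !coef_map /=; apply => y ys.
by rewrite -normCK (iso _ x) ?rootP.
Qed.

Lemma isotropic_form (p : {poly int}) :
  p \is monic -> p`_0 = 2 \/ p`_0 = - 2 ->
  (forall z w : C, root (map_poly intr p) z -> root (map_poly intr p) w ->
    `|z| = `|w|) ->
  (1 < size p)%N /\ exists m q, [/\ (0 < m)%N, p = q \Po 'X^m &
    (exists2 c : int, c = 2 \/ c = - 2 & q = 'X + c%:P) \/
    (exists2 a : int, `|a| <= 2 & q = 'X^2 + a%:P * 'X + 2%:P)].
Proof.
move=> pm p0 iso.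
have p1 : (1 < size p)%N.
  rewrite ltnNge; apply/negP => /size1_polyC pC; move: p0 pm.
  by rewrite pC monicE lead_coefC coefC eqxx => -[] ->.
split => //.
have [rho [rho0 [x px xrho] sym]] := isotropic_coef_symmetry pm p1 iso.
set d := (size p).-1 in sym.
have dS : size p = d.+1 by rewrite /d prednK// (ltn_trans _ p1).
have d0 : (0 < d)%N by rewrite -ltnS -dS.
have pd : p`_d = 1 by rewrite -(monicP pm) /lead_coef dS.
have p04 : p`_0 ^+ 2 = 4 by case: p0 => ->.
have rhod : rho ^+ d = (4 : int)%:~R.
  have := sym d 0%N (addn0 d); rewrite pd mul1r => ->.
  by rewrite -expr2 -rmorphXn/= p04.
(* The [d]-th power replaces [rho], which need not be an integer, by [rho ^+ d = 4]. *)
have symZ i j : (i + j)%N = d -> p`_i ^+ d * 4 ^+ i = p`_0 ^+ d * p`_j ^+ d.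
  move=> /sym /(congr1 (fun y => y ^+ d)).
  rewrite /= !exprMn (exprAC rho i d) rhod -!rmorphXn -!rmorphM /=.
  by move=> /intr_inj.
have symN i j : (i + j)%N = d ->
    (absz (p`_i)%R ^ d * 4 ^ i = 2 ^ d * absz (p`_j)%R ^ d)%N.
  move=> /symZ /(congr1 absz); rewrite !abszM !abszX.
  by case: p0 => ->.
have pi0 i : (0 < i < d)%N -> (i + i)%N <> d -> p`_i = 0.
  move=> /andP[i0 id] iid; apply/eqP; apply/negP => /negP pi.
  have := symN i (d - i)%N (subnKC (ltnW id)) => E.
  have pj : p`_(d - i) != 0.
    apply/eqP => pj; move: E; rewrite pj absz0 exp0n// muln0 => /eqP.
    by rewrite muln_eq0 !expn_eq0 absz_eq0 (negPf pi).
  have := congr1 (logn 2) E.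
  rewrite !lognM ?expn_gt0 ?absz_gt0 ?pi ?pj//= !lognX.
  rewrite (_ : logn 2 4 = 2%N)//= (_ : logn 2 2 = 1%N)//= muln1.
  set k := logn 2 (absz p`_i); set l := logn 2 _ => Ekl.
  (* From [d k + 2 i = d + d l], [d] divides [2 i]; as [0 < i < d], this leaves only [2 i = d]. *)
  have : (d %| i * 2)%N.
    by rewrite -(dvdn_addr (m := d * k)%N) ?dvdn_mulr// Ekl dvdn_addr ?dvdn_mulr.
  move=> /dvdnP[[|[|t]]] e.
  - by lia.
  - by apply: iid; lia.
  - by nia.
have [[m [md pmn0]]|nm] := pselect (exists m, (m + m)%N = d /\ p`_m != 0); last first.
  exists d, ('X + (p`_0)%:P); split => //; last by left; exists p`_0.
  rewrite comp_polyD comp_polyX comp_polyC; apply/polyP => i.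
  rewrite coefD coefXn coefC.
  have [->|i0] := eqVneq i 0%N; first by rewrite eq_sym (gtn_eqF d0) add0r.
  have [->|id] := eqVneq i d; first by rewrite pd addr0.
  rewrite addr0; have [id'|di] := ltnP i d; last first.
    by rewrite nth_default// dS ltn_neqAle eq_sym id.
  have [iid|] := eqVneq (i + i)%N d; last first.
    by move=> /eqP; apply: pi0; rewrite lt0n i0.
  by apply/eqP; apply/negP => /negP pi; apply: nm; exists i.
(* The symmetry at the nonzero middle coefficient makes the constant term a power of [rho], hence
   nonnegative, hence 2. *)
have rhom : rho ^+ m = (p`_0)%:~R.
  have /eqP := sym m m md; rewrite mulrC -subr_eq0 -mulrBl mulf_eq0 subr_eq0.
  by rewrite intr_eq0 (negPf pmn0) orbF => /eqP.
have p02 : p`_0 = 2.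
  case: p0 => // p0; move: rhom; rewrite p0 => rhom.
  have : 0 <= rho ^+ m by rewrite !exprn_ge0.
  by rewrite rhom ler0z.
have m0 : (0 < m)%N by lia.
have pE : p = 'X^d + (p`_m)%:P * 'X^m + 2%:P.
  apply/polyP => i; rewrite !coefD coefXn coefCM coefXn coefC.
  have [->|i0] := eqVneq i 0%N.
    rewrite [0%N == d]eq_sym (gtn_eqF d0) [0%N == m]eq_sym (gtn_eqF m0).
    by rewrite mulr0 !add0r.
  have [->|id] := eqVneq i d.
    by rewrite pd gtn_eqF ?mulr0 ?addr0// -md -[X in (X < _)%N]addn0 ltn_add2l.
  have [->|im] := eqVneq i m; first by rewrite mulr1 add0r addr0.
  rewrite mulr0 !addr0; have [id'|di] := ltnP i d; last first.
    by rewrite nth_default// dS ltn_neqAle eq_sym id.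
  by apply: pi0; [rewrite lt0n i0|move=> iid; move/eqP: im; lia].
exists m, ('X^2 + (p`_m)%:P * 'X + 2%:P); split => //.
  rewrite !comp_polyD comp_Xn_poly comp_polyM comp_polyX !comp_polyC -exprM.
  by rewrite muln2 -addnn md.
right; exists p`_m => //.
(* For the root [y = x ^+ m] of the quadratic, [|y|^2 = 2] and [a y = - (y^2 + 2)], so
   [|a| |y| <= 4]. Squaring gives [2 a^2 <= 16], and [a] is an integer. *)
have y2 : `|x ^+ m| ^+ 2 = 2%:~R.
  by rewrite normrX exprAC xrho rhom p02.
have hornerP (a b : int) (k l : nat) :
    (map_poly intr ('X^k + a%:P * 'X^l + b%:P)).[x] = x ^+ k + a%:~R * x ^+ l + b%:~R.
  by rewrite !rmorphD rmorphM /= !map_polyXn !map_polyC !hornerE.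
have h1 : (p`_m)%:~R * x ^+ m = - (x ^+ m * x ^+ m + 2%:~R) :> C.
  move: px; rewrite /root [in X in X -> _]pE hornerP -md exprD.
  move: (p`_m) 2 (x ^+ m) => a b y /eqP h.
  by apply/eqP; rewrite -subr_eq0 opprK; apply/eqP; rewrite -[RHS]h; ring.
have h2 : (`|p`_m|%:~R : C) * `|x ^+ m| <= 4%:~R.
  rewrite intr_norm -normrM h1 normrN (le_trans (ler_normD _ _))//.
  by rewrite normrM -expr2 y2 -intr_norm -natrD.
have h3 : ((`|p`_m|%:~R : C) * `|x ^+ m|) ^+ 2 <= 4%:~R ^+ 2.
  by rewrite lerXn2r ?nnegrE// mulr_ge0// ler0z.
move: h3; rewrite exprMn y2 -!rmorphXn -rmorphM/= ler_int.
by move: (p`_m) => a; nia.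
Qed.
End Isotropic.

(** * Companion matrices *)

Lemma horner_mx_comp_Xn (R : comNzRingType) n (A : 'M[R]_n.+1) m (q : {poly R}) :
  horner_mx A (q \Po 'X^m) = horner_mx (A ^+ m) q.
Proof.
elim/poly_ind: q => [|q c IH]; first by rewrite comp_poly0 !rmorph0.
rewrite comp_polyD comp_polyM comp_polyX comp_polyC !rmorphD !rmorphM /= IH.
by rewrite !horner_mx_C horner_mx_X rmorphXn /= horner_mx_X.
Qed.

Lemma horner_mx_quadratic (R : comNzRingType) n (A : 'M[R]_n.+1) (a b : R) :
  horner_mx A ('X^2 + a%:P * 'X + b%:P) = A ^+ 2 + a *: A + b%:M.
Proof.
rewrite 2!rmorphD [in X in _ + X + _]rmorphM /= (rmorphXn _ 2 'X) /= horner_mx_X.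
by rewrite !horner_mx_C -[_%:M * _]/(_ *m _) mul_scalar_mx.
Qed.

Section Companion.
Context (n : nat) (p : {poly int}).
Hypothesis p_monic : p \is monic.
Hypothesis p_size : size p = n.+2.

Definition companion_int : 'M[int]_n.+1 :=
  \matrix_(i, j) if j == n :> nat then - p`_i else (j.+1 == i)%:R.

Definition basis0 : 'cV[int]_n.+1 := \col_i (i == 0%N :> nat)%:R.

Local Notation M := companion_int.
Local Notation ev g := (horner_mx M g *m basis0).

Lemma companion_exp_basis0 k : (k < n.+1)%N ->
  M ^+ k *m basis0 = \col_i (i == k :> nat)%:R.
Proof.
elim: k => [|k IH] kn; first by rewrite expr0 mul1mx.
rewrite exprS -mulmxA (IH (ltnW kn)); move: kn; rewrite ltnS => kn.
apply/colP => i; rewrite !mxE.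
rewrite (bigD1 (Ordinal (ltnW kn : (k < n.+1)%N)))//= big1 => [|j jk].
  by rewrite !mxE /= eqxx mulr1 addr0 (ltn_eqF kn) eq_sym.
rewrite !mxE -[j == k :> nat]/(j == Ordinal (ltnW kn : (k < n.+1)%N)).
by rewrite (negbTE jk) mulr0.
Qed.

Lemma horner_mx_expand (g : {poly int}) k : (size g <= k)%N ->
  ev g = \sum_(i < k) g`_i *: (M ^+ i *m basis0).
Proof.
move=> gk; have -> : g = \sum_(i < k) g`_i *: 'X^i.
  by rewrite -poly_def; apply/polyP => i; rewrite coef_poly; case: ltnP => // ki;
     rewrite nth_default// (leq_trans gk).
rewrite rmorph_sum mulmx_suml; apply: eq_bigr => i _.
rewrite -mul_polyC rmorphM /= horner_mx_C rmorphXn /= horner_mx_X.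
rewrite -mulmxA mul_scalar_mx; congr (_ *: _).
rewrite coef_sum (bigD1 i)//= coefZ coefXn eqxx mulr1 big1 ?addr0// => j ji.
by rewrite coefZ coefXn (negbTE (_ : (i != j :> nat))) ?mulr0// eq_sym.
Qed.

(** [basis0] is a cyclic vector: its first powers under [M] are the standard basis. Integer vectors
    can thus be handled as polynomials, with [M] acting as multiplication by [X]. *)
Lemma ev_surj z : exists g, z = ev g.
Proof.
exists (\poly_(i < n.+1) z (inord i) 0).
rewrite (horner_mx_expand (size_poly _ _)); apply/colP => i.
rewrite summxE (bigD1 i)//= big1 => [|j ji].
  rewrite addr0 coef_poly ltn_ord inord_val mxE (companion_exp_basis0 (ltn_ord i)).
  by rewrite mxE eqxx mulr1.
rewrite mxE (companion_exp_basis0 (ltn_ord j)) mxE eq_sym.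
rewrite (_ : (_ == _) = false) ?mulr0//.
exact: negbTE.
Qed.

Lemma ev_p : ev p = 0.
Proof.
rewrite (horner_mx_expand (k := n.+2)) ?p_size// big_ord_recr /=.
have -> : p`_n.+1 = 1 by rewrite -[RHS](monicP p_monic) /lead_coef p_size.
rewrite scale1r exprS -mulmxA (companion_exp_basis0 (ltnSn n)).
apply/colP => i; rewrite !mxE summxE (bigD1 i)//= big1 => [|j ji].
  rewrite addr0 mxE (companion_exp_basis0 (ltn_ord i)) mxE eqxx mulr1.
  rewrite (bigD1 ord_max)//= big1 => [|j jn].
    by rewrite !mxE eqxx mulr1 addr0 addrN.
  by rewrite !mxE (_ : (j == n :> nat) = false) ?mulr0//; exact: negbTE.
rewrite mxE (companion_exp_basis0 (ltn_ord j)) mxE eq_sym.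
rewrite (_ : (_ == _) = false) ?mulr0//.
exact: negbTE.
Qed.

(** [p(M)] kills the cyclic vector and commutes with [M], so it kills every basis vector. *)
Lemma horner_companion : horner_mx M p = 0.
Proof.
apply/matrixP => i j; rewrite mxE.
have <- : (horner_mx M p *m (M ^+ j *m basis0)) i 0 = horner_mx M p i j.
  rewrite (companion_exp_basis0 (ltn_ord j)) mxE (bigD1 j)//= big1 => [|k kj].
    by rewrite mxE eqxx mulr1 addr0.
  by rewrite mxE (_ : (k == j :> nat) = false) ?mulr0//; exact: negbTE.
rewrite mulmxA (_ : horner_mx M p *m M ^+ j = M ^+ j *m horner_mx M p).
  by rewrite -mulmxA ev_p mulmx0 mxE.
have -> : M ^+ j = horner_mx M 'X^j by rewrite rmorphXn /= horner_mx_X.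
by rewrite -[LHS]rmorphM mulrC rmorphM.
Qed.

(** The Horner scheme of a digit polynomial is a walk by the steps [M z + c basis0]. *)
Lemma companion_digits (P : 'cV[int]_n.+1 -> Prop) :
  (forall g, digit_representable p g) -> P 0 ->
  (forall z c, c \in [:: -1; 0; 1] -> P z -> P (M *m z + c *: basis0)) ->
  forall z, P z.
Proof.
move=> pD P0 PS z; have [g ->] := ev_surj z.
have [f [h [fD ->]]] := pD g.
rewrite rmorphD rmorphM /= horner_companion mulr0 addr0.
elim/poly_ind: f fD => [|f c IH]; first by rewrite rmorph0 mul0mx.
move=> /digit_polyMXaddC[fD cD].
rewrite rmorphD mulrC rmorphM /= horner_mx_X horner_mx_C mulmxDl mul_scalar_mx.
by rewrite -mulmxA; apply: PS => //; exact: IH.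
Qed.

Hypothesis p0 : p`_0 = 2 \/ p`_0 = - 2.

(** Writing [p = X q + p(0)] gives [M q(M) = - p(0)]. This yields both invertibility of [M] over the
    reals and [2 Z^d] inside [M Z^d]. *)
Lemma companion_cofactor : exists Q : 'M[int]_n.+1, M *m Q = 2%:M.
Proof.
pose q := \poly_(i < n.+1) p`_i.+1.
have pE : p = 'X * q + (p`_0)%:P.
  apply/polyP => i; rewrite coefD coefXM coefC coef_poly.
  case: i => [|i] /=; first by rewrite add0r.
  by rewrite addr0; case: ltnP => // ni; rewrite nth_default// p_size.
have := horner_companion; rewrite pE rmorphD rmorphM /= horner_mx_X horner_mx_C.
move=> /eqP; rewrite addr_eq0 => /eqP MQ.
case: p0 MQ => ->; [exists (- horner_mx M q)|exists (horner_mx M q)].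
  by rewrite mulmxN -[_ *m _]/(_ * _) MQ opprK.
by rewrite -[_ *m _]/(_ * _) MQ raddfN opprK.
Qed.

Lemma companion_digit_exists z :
  exists (b : bool) z', z = M *m z' + b%:R *: basis0.
Proof.
have [g ->] := ev_surj z; have [Q MQ] := companion_cofactor.
have -> : g = 'X * (\poly_(i < size g) g`_i.+1) + (g`_0)%:P.
  apply/polyP => i; rewrite coefD coefXM coefC coef_poly.
  case: i => [|i] /=; first by rewrite add0r.
  by rewrite addr0; case: ltnP => // ni; rewrite nth_default// (leq_trans ni).
rewrite rmorphD rmorphM /= horner_mx_X horner_mx_C mulmxDl mul_scalar_mx.
have [b [k ->]] : exists (b : bool) k, g`_0 = k * 2 + b%:R.
  have := divz_eq g`_0 2; have := @modz_ge0 g`_0 2 isT; have := @ltz_pmod g`_0 2 isT.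
  move: (_ %% _)%Z (_ %/ _)%Z => r k r2 r0 E.
  have [r00|r1] : r = 0 \/ r = 1 by lia.
    by exists false, k; rewrite E r00.
  by exists true, k; rewrite E r1.
exists b, (horner_mx M (\poly_(i < size g) g`_i.+1) *m basis0 + k *: (Q *m basis0)).
rewrite mulmxDr -scalemxAr !mulmxA MQ mul_scalar_mx scalerA scalerDl addrA.
by [].
Qed.

End Companion.

(** * Geometric decay of matrix powers *)

Section Decay.
Context (R : realType).

Lemma geometric_entries_small d (U : 'M[R]_d) (K : R) :
  (forall n i j, (U ^+ n) i j ^+ 2 <= K / 2 ^+ n) ->
  exists2 n, (0 < n)%N & mxnorm1 (U ^+ n) <= 2^-1.
Proof.
(* The [d * d] entries, each at most [eps], sum to at most 1/2; the added 1 keeps the inverted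
   number positive when [d = 0]. *)
move=> UK; pose eps : R := (2 * ((d * d)%:R + 1))^-1.
have dd0 : (0 : R) <= (d * d)%:R by exact: ler0n.
have eps0 : 0 < eps by rewrite invr_gt0; lra.
pose n := (Num.bound (`|K| / eps ^+ 2)).+1.
exists n => //.
have nK : K / 2 ^+ n <= eps ^+ 2.
  rewrite ler_pdivrMr ?exprn_gt0// mulrC -ler_pdivrMr ?exprn_gt0//.
  apply: (@le_trans _ _ n%:R); last first.
    by rewrite -natrX ler_nat ltnW// ltn_expl.
  apply: (@le_trans _ _ (`|K| / eps ^+ 2)).
    by rewrite ler_wpM2r ?invr_ge0 ?exprn_ge0 ?(ltW eps0)// ler_norm.
  apply: le_trans (ltW (archi_boundP _)) _; last by rewrite ler_nat.
  by rewrite divr_ge0// exprn_ge0// ltW.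
have Un i j : `|(U ^+ n) i j| <= eps.
  rewrite -(@ler_pXn2r _ 2) ?nnegrE ?(ltW eps0)// real_normK ?num_real//.
  exact: le_trans (UK n i j) nK.
apply: (@le_trans _ _ (\sum_(i < d) \sum_(j < d) (eps : R))).
  by apply: ler_sum => i _; apply: ler_sum => j _; exact: Un.
rewrite sumr_const card_ord sumr_const card_ord -mulrnA -[X in X <= _]mulr_natl.
have e1 : eps * (2 * ((d * d)%:R + 1)) = 1 by rewrite mulVf//; lra.
move: (d * d)%:R dd0 e1 => dd dd0 e1. nra.
Qed.

(** Splitting off the first [N] terms gives [S (N + n) <= S N + S n / 2], so [2 * S N] bounds all
    partial sums. *)
Lemma mxnorm1_exp_summable d (V : 'M[R]_d) N :
  (0 < N)%N -> mxnorm1 (V ^+ N) <= 2^-1 ->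
  exists C, forall n, \sum_(i < n) mxnorm1 (V ^+ i) <= C.
Proof.
move=> N0 VN; pose S n := \sum_(i < n) mxnorm1 (V ^+ i).
have S0 n : 0 <= S n by apply: sumr_ge0 => i _; exact: mxnorm1_ge0.
have SN n : S (N + n)%N <= S N + 2^-1 * S n.
  rewrite /S big_split_ord /= lerD2l mulr_sumr; apply: ler_sum => i _.
  rewrite exprD (le_trans (mxnorm1_mul _ _))// ler_wpM2r// mxnorm1_ge0//.
exists (2 * S N) => n; rewrite -/(S n).
have [k] := ubnP n; elim: k n => // k IH n nk.
have [nN|Nn] := leqP n N.
  apply: (@le_trans _ _ (S N)); last by have := S0 N; lra.
  rewrite /S -(subnKC nN) big_split_ord /= lerDl.
  by apply: sumr_ge0 => i _; exact: mxnorm1_ge0.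
rewrite -(subnKC (ltnW Nn)); apply: le_trans (SN _) _.
have : S (n - N)%N <= 2 * S N by apply: IH; lia.
lra.
Qed.

Lemma quadratic_entries_decay d (U : 'M[R]_d) (a : R) : a ^+ 2 <= 4 ->
  1 + a *: U + 2 *: U ^+ 2 = 0 ->
  exists K, forall n i j, (U ^+ n) i j ^+ 2 <= K / 2 ^+ n.
Proof.
move=> a4 Ueq; pose t i j n := (U ^+ n) i j.
have tE i j n : 2 * t i j n.+2 = - (a * t i j n.+1 + t i j n).
  have UU k : U ^+ n *m U ^+ k = U ^+ (n + k) by rewrite exprD.
  have : U ^+ n *m (U ^+ 0 + a *: U ^+ 1 + 2 *: U ^+ 2) = 0 by rewrite Ueq mulmx0.
  rewrite !mulmxDr -!scalemxAr !UU addn0 addn1 addn2 => /matrixP/(_ i j).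
  rewrite /t; move: (U ^+ n) (U ^+ n.+1) (U ^+ n.+2) => A B C'.
  by rewrite !mxE; lra.
(* The quadratic form that the recurrence [tE] multiplies by 1/2 at each step;
   it is positive definite because a^2 < 8. *)
pose E i j n := 2 * t i j n.+1 ^+ 2 + a * t i j n * t i j n.+1 + t i j n ^+ 2.
have EE i j n : E i j n = E i j 0%N / 2 ^+ n.
  elim: n => [|n IH]; first by rewrite expr0 divr1.
  rewrite exprS invfM mulrA -[_ / 2 / _]mulrAC -IH /E.
  have := tE i j n; move: (t i j n) (t i j n.+1) (t i j n.+2) => x y z xyz.
  have -> : z = - (a * y + x) / 2 by lra.
  by field.
have tEn i j n : t i j n ^+ 2 <= 2 * E i j n.
  rewrite /E; move: (t i j n) (t i j n.+1) => x y.
  (* [4 (2 E - x^2) = (a x + 4 y)^2 + (4 - a^2) x^2]. *)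
  have := sqr_ge0 (a * x + 4 * y); have := mulr_ge0 (sqr_ge0 x) (_ : 0 <= 4 - a ^+ 2).
  rewrite subr_ge0 => /(_ a4); nra.
pose K := \sum_i \sum_j (2 * E i j 0%N : R).
exists K => n i j.
apply: le_trans (tEn i j n) _; rewrite EE mulrA ler_pM2r ?invr_gt0 ?exprn_gt0//.
have E0 k l : 0 <= 2 * E k l 0%N by apply: le_trans (tEn k l 0%N); exact: sqr_ge0.
apply: le_trans (ler_term_sum (F := fun j => 2 * E i j 0%N : R) j _) _ => //.
apply: (ler_term_sum (F := fun i => \sum_j (2 * E i j 0%N : R))) => k.
exact: sumr_ge0.
Qed.

End Decay.

(** * The attractor of a companion matrix of the special form *)

Section CompanionTile.
Context (R : realType) (n : nat) (p : {poly int}).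
Hypothesis p_monic : p \is monic.
Hypothesis p_size : size p = n.+2.
Hypothesis p0 : p`_0 = 2 \/ p`_0 = - 2.
Variables (m : nat) (q : {poly int}).
Hypothesis m0 : (0 < m)%N.
Hypothesis pE : p = q \Po 'X^m.
Hypothesis qE : (exists2 c : int, c = 2 \/ c = - 2 & q = 'X + c%:P) \/
  (exists2 a : int, `|a| <= 2 & q = 'X^2 + a%:P * 'X + 2%:P).

Local Notation iv := (map_mx (intr : int -> R)).
Local Notation M := (companion_int n p).
Local Notation Mr := (iv M).
Local Notation V := (invmx Mr).

Let M_unit : Mr \in unitmx.
Proof.
have [Q MQ] := companion_cofactor p_monic p_size p0.
have : Mr *m (2^-1 *: iv Q) = 1%:M.
  rewrite -scalemxAr -map_mxM MQ map_scalar_mx -scalemx1 scalerA mulVf ?scale1r//.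
by move=> /mulmx1_unit[].
Qed.

Let horner_q : horner_mx (M ^+ m) q = 0.
Proof.
by rewrite -horner_mx_comp_Xn -pE; exact: horner_companion.
Qed.

(** [q] annihilates [M ^+ m], so [V ^+ m] is a scalar of modulus 1/2 or a root of the reversed
    quadratic. Its powers decay in either case, and one small power of [V] suffices. *)
Let inverse_decay : exists C, forall k, \sum_(i < k) mxnorm1 (V ^+ i) <= C.
Proof.
suff [K UK] : exists K : R, forall k i j, ((V ^+ m) ^+ k) i j ^+ 2 <= K / 2 ^+ k.
  have [k k0 Uk] := geometric_entries_small UK.
  apply: (@mxnorm1_exp_summable _ _ _ (m * k)); first by rewrite muln_gt0 m0.
  by rewrite exprM.
have UW : V ^+ m * Mr ^+ m = 1.
  by rewrite -[V]/(Mr^-1) exprVn mulVr// unitrX.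
have MrE k : Mr ^+ k = iv (M ^+ k) by rewrite rmorphXn.
case: qE => [[c c2 qc]|[a a2 qa]].
  have W : Mr ^+ m = (- c%:~R)%:M.
    have := horner_q; rewrite qc rmorphD /= horner_mx_X horner_mx_C => /eqP.
    by rewrite addr_eq0 MrE => /eqP ->; rewrite map_mxN map_scalar_mx raddfN.
  have cR : (c%:~R : R) ^+ 2 = 4 by case: c2 => ->; rewrite -rmorphXn.
  have c0 : (c%:~R : R) != 0 by rewrite intr_eq0; case: c2 => ->.
  have U : V ^+ m = (- (c%:~R)^-1)%:M.
    rewrite -[LHS]mulr1 (_ : 1 = Mr ^+ m * (- (c%:~R)^-1)%:M); last first.
      by rewrite W -[RHS]scalar_mxM mulrNN mulfV.
    by rewrite mulrA UW mul1r.
  exists 1 => k i j; rewrite U -(rmorphXn (@scalar_mx R n.+1)) /= mxE.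
  case: (i == j); last by rewrite mulr0n expr0n/= mul1r invr_ge0 exprn_ge0.
  rewrite mulr1n exprAC sqrrN exprVn cR exprVn mul1r lef_pV2 ?posrE ?exprn_gt0//.
  by rewrite lerXn2r ?nnegrE//; lra.
apply: (@quadratic_entries_decay _ _ _ a%:~R).
  by rewrite -rmorphXn /= -[4]/(4%:~R) ler_int; nia.
have W : Mr ^+ m ^+ 2 + a%:~R *: Mr ^+ m + 2%:M = 0.
  have := horner_q; rewrite qa horner_mx_quadratic => /(congr1 iv).
  by rewrite !map_mxD map_mxZ map_scalar_mx map_mx0 MrE rmorphXn.
(* Multiplying by the square of the inverse reverses the coefficients. *)
rewrite -[RHS](mul0r (V ^+ m ^+ 2)) -W.
have WU : Mr ^+ m * V ^+ m = 1.
  by rewrite -[V]/(Mr^-1) exprVn mulrV// unitrX.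
rewrite !mulrDl -scalerAl -[2%:M * _]/(_ *m _) mul_scalar_mx.
move: (V ^+ m) (Mr ^+ m) WU => U W' WU; rewrite !expr2.
by rewrite -mulrA (mulrA W' U) WU mul1r WU.
Qed.

Lemma companion_tile : tile (attractor Mr [set 0; iv (basis0 n)]).
Proof.
have [C decay] := inverse_decay.
have e_cube : cube 1 (iv (basis0 n)).
  by move=> i; rewrite !mxE; case: (_ == _); rewrite ?normr1 ?normr0.
have C2 : 2 * C <= 2 * C by [].
have digit_exists := companion_digit_exists p_monic p_size p0.
have pD g : digit_representable p g.
  rewrite pE; apply: digit_representable_comp => // {}g.
  case: qE => [[c c2 ->]|[a a2 ->]]; first exact: digit_representable_monic_linear.
  exact: digit_representable_monic_quadratic.
have mG := attractor_measurable M_unit e_cube decay C2.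
split; first exact: mG.
apply: (volume_tile (M := M) (e := basis0 n)) => //.
- exact: (volume_attractor_fin M_unit e_cube decay C2).
- move=> A mA; rewrite -(@volume_companion _ _ (fun i => (p`_i)%:~R) Mr A) //.
  + by rewrite -intr_norm; case: p0 => ->.
  + by rewrite intr_eq0; case: p0 => ->.
  + by move=> i j; rewrite !mxE; case: ifP => _; rewrite ?rmorphN ?rmorph_nat.
- exact: (attractor_self M_unit e_cube decay C2).
- by move=> P P0 PS; exact: (companion_digits p_monic p_size pD P0 PS).
- exact: (attractor_cover M_unit e_cube decay C2).
Qed.

End CompanionTile.

Theorem theorem7 (R : realType) (p : {poly int})
    (pmonic : p \is monic)
    (p0 : p`_0 = 2 \/ p`_0 = - 2)
    (pexp : expanding (map_poly intr p : {poly R[i]}))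
    (piso : isotropic (map_poly intr p : {poly R[i]})) :
  let M : 'M[R]_((size p).-1) := companion R p in
  let e : 'cV[R]_((size p).-1) := \col_i (i == 0%N :> nat)%:R in
  tile (attractor M [set 0; e]).
Proof.
have [p1 [m [q [m0 pE qE]]]] := isotropic_form pmonic p0 piso.
have [n pn] : exists n, (size p).-1 = n.+1.
  by case: (size p) p1 => [|[|n]]// _; exists n.
have p_size : size p = n.+2 by rewrite -pn prednK// (ltn_trans _ p1).
move=> M e.
have ME i j : M i j =
    (if j == (size p).-2 :> nat then - p`_i else (j.+1 == i)%:R)%:~R.
  by rewrite !mxE.
have eE i : e i 0 = (i == 0%N :> nat)%:R by rewrite mxE.
(* The dimension occurs in the types of [M] and [e]; they are generalised, known only by their
   entries, before it is rewritten. *)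
move: M e ME eE; rewrite pn => M e ME eE.
have -> : M = map_mx intr (companion_int n p).
  by apply/matrixP => i j; rewrite ME !mxE.
have -> : e = map_mx intr (basis0 n).
  by apply/colP => i; rewrite eE !mxE; case: (_ == _).
exact: (companion_tile R pmonic p_size p0 m0 pE qE).
Qed.
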